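(* As $d\to\infty$, \[ \theta(d)\geq (1-o(1))\frac{d\log d}{2^{d+1}}\,, \] i.e. for every $\varepsilon>0$ there is $d_0$ such that for all $d\geq d_0$ there exist packings of unit-volume balls in $\mathbb{R}^d$ of density at least $(1-\varepsilon)\, d\log d/2^{d+1}$.
   Context: Let $r_d$ be the radius of the Euclidean ball of volume $1$ in $\mathbb{R}^d$. A sphere packing is a set $\mathcal P\subseteq\mathbb{R}^d$ with $\|x-y\|\geq 2r_d$ for all distinct $x,y\in\mathcal P$ (the centres of disjoint balls of volume $1$). The sphere packing density is \[ \theta(d)=\sup_{\mathcal P}\limsup_{R\to\infty}\frac{|\mathcal P\cap B_0(R)|}{\mathrm{Vol}(B_0(R))}, \] the supremum over all sphere packings, where $B_0(R)$ is the closed ball of radius $R$ about the origin. $\log$ denotes the natural logarithm. *)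

(* Defs.v *)
From HB Require Import structures.
From mathcomp Require Import all_boot all_order all_algebra.
From mathcomp Require Import all_classical all_reals all_analysis.
Set Implicit Arguments. Unset Strict Implicit. Unset Printing Implicit Defensive.
Import Order.TTheory GRing.Theory Num.Theory.
Local Open Scope classical_set_scope.
Local Open Scope ring_scope.

(* d-dimensional Lebesgue measure, defined as the iterated (Tonelli/Cavalieri)
   integral of one-dimensional Lebesgue measure:
     vol_0 A = 1 if A contains the (unique) point of R^0, 0 otherwise;
     vol_{n+1} A = \int vol_n (x-section of A) dx.
   On Borel sets (e.g. balls) this is the Lebesgue measure of R^d. *)
Fixpoint vol (R : realType) (n : nat) : set (n.-tuple R) -> \bar R :=
  match n return set (n.-tuple R) -> \bar R with
  | 0 => fun A => ((\1_A [tuple] : R)%:E)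
  | n'.+1 => fun A =>
      (\int[@lebesgue_measure R]_x @vol R n' [set t | A (cons_tuple x t)])%E
  end.

Definition sqdist (R : realType) (d : nat) (x y : d.-tuple R) : R :=
  \sum_(i < d) (tnth x i - tnth y i) ^+ 2.

Definition ball0 (R : realType) (d : nat) (rho : R) : set (d.-tuple R) :=
  [set x | sqdist x [tuple of nseq d 0] <= rho ^+ 2].

Definition r_ (R : realType) (d : nat) : R :=
  xget 0 [set r : R | 0 < r /\ vol (@ball0 R d r) = 1%E].

Definition sphere_packing (R : realType) (d : nat) (P : set (d.-tuple R)) :=
  forall x y, P x -> P y -> x <> y -> (2 * r_ R d) ^+ 2 <= sqdist x y.

Definition count_in (R : realType) (d : nat) (P : set (d.-tuple R)) (rho : R)
  : \bar R := (\esum_(x in P `&` @ball0 R d rho) 1)%E.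

Definition limsup_pinfty (R : realType) (g : R -> \bar R) : \bar R :=
  ereal_inf [set ereal_sup [set g rho | rho in [set rho | M <= rho]] | M in [set: R]].

Definition packing_density (R : realType) (d : nat) (P : set (d.-tuple R)) : \bar R :=
  limsup_pinfty (fun rho : R =>
    (count_in P rho * ((fine (vol (@ball0 R d rho)))^-1)%:E)%E).

Definition theta (R : realType) (d : nat) : \bar R :=
  ereal_sup [set packing_density P | P in [set P | @sphere_packing R d P]].

(* Main.v *)
Require Import Defs.
From HB Require Import structures.
From mathcomp Require Import all_boot all_order all_algebra.
From mathcomp Require Import all_classical all_reals all_analysis.
From mathcomp Require Import measurable_realfun.
From mathcomp Require Import ring lra zify.
Import Order.TTheory GRing.Theory Num.Theory.
Local Open Scope classical_set_scope.
Local Open Scope ring_scope.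

Set Implicit Arguments.
Unset Strict Implicit.
Unset Printing Implicit Defensive.

(** Work on a large box of integer points, rescaled so that two centres conflict
    when they are at distance less than [2 rad].  A random subset of density chosen
    so that the expected degree is [X = x ^ d], with [x ^ 2 = d / (576 ln d)], has
    after a few deletions maximum degree about [X], while any two of its points are
    at distance at least [rad / x], so that by the midpoint bound their common
    neighbourhoods have size at most [2 X / d ^ 9].

    For a graph with maximum degree [D] and codegrees at most [eps D],
    [eps = 1 / (ln D) ^ 4], a nibble gives an independent set of density
    [(1 - o(1)) ln D / D]: pick each vertex with probability [g / D], keep the picked
    vertices without picked neighbour, and continue on the vertices that are neither
    picked nor adjacent to a picked one.  Degrees and codegrees shrink by a factor
    about [exp (- g)] per round.  Only upper bounds on them are needed, and the number
    of survivors in a set is a decreasing function of the random choice, so that its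
    upper tail is controlled by a second moment which small codegrees make small.
    As [ln X] is asymptotically [d ln d / 2], tiling space by translates of the box
    gives the packing. *)

(** * Random subsequences *)

(** Expectation of [f] at a random subsequence of [s] keeping each entry independently with
    probability [p]. The recursion conditions on the head, so the facts below are inductions on
    [s]. *)
Fixpoint bexp (R : realType) (T : Type) (p : R) (s : seq T) (f : seq T -> R) : R :=
  if s is x :: s' then
    p * bexp p s' (fun X => f (x :: X)) + (1 - p) * bexp p s' f
  else f [::].

Section Bernoulli.
Variables (R : realType) (T : eqType) (p : R).
Hypothesis p01 : 0 <= p <= 1.
Implicit Types (s X Y : seq T) (f g : seq T -> R).

Let p0 : 0 <= p. Proof. by case/andP: p01. Qed.
Let q0 : 0 <= 1 - p. Proof. by rewrite subr_ge0; case/andP: p01. Qed.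

Lemma eq_bexp s f g : (forall X, {subset X <= s} -> f X = g X) ->
  bexp p s f = bexp p s g.
Proof.
elim: s f g => [|x s IH] f g fg /=; first by apply: fg.
congr (_ * _ + _ * _); apply: IH => X Xs; apply: fg => y.
  by rewrite !inE => /orP[->//|/Xs ->]; rewrite orbT.
by move=> /Xs; rewrite inE => ->; rewrite orbT.
Qed.

Lemma ler_bexp s f g : (forall X, {subset X <= s} -> f X <= g X) ->
  bexp p s f <= bexp p s g.
Proof.
elim: s f g => [|x s IH] f g fg /=; first by apply: fg.
apply: lerD; apply: ler_wpM2l => //; apply: IH => X Xs; apply: fg => y.
  by rewrite !inE => /orP[->//|/Xs ->]; rewrite orbT.
by move=> /Xs; rewrite inE => ->; rewrite orbT.
Qed.

Lemma bexp_cst s c : bexp p s (fun=> c) = c.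
Proof. by elim: s => [//|x s IH] /=; rewrite !IH; ring. Qed.

Lemma bexpD s f g : bexp p s (fun X => f X + g X) = bexp p s f + bexp p s g.
Proof. by elim: s f g => [//|x s IH] f g /=; rewrite !IH; ring. Qed.

Lemma bexpZ s c f : bexp p s (fun X => c * f X) = c * bexp p s f.
Proof. by elim: s f => [//|x s IH] f /=; rewrite !IH; ring. Qed.

Lemma bexpB s f g : bexp p s (fun X => f X - g X) = bexp p s f - bexp p s g.
Proof.
rewrite bexpD; congr (_ + _); rewrite -mulN1r -bexpZ.
by apply: eq_bexp => X _; rewrite mulN1r.
Qed.

Lemma bexp_sum (I : Type) (r : seq I) (P : pred I) s (F : I -> seq T -> R) :
  bexp p s (fun X => \sum_(i <- r | P i) F i X) =
  \sum_(i <- r | P i) bexp p s (F i).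
Proof.
elim: r => [|i r IH].
  by rewrite big_nil -[RHS](bexp_cst s); apply: eq_bexp => X _; rewrite big_nil.
rewrite big_cons -IH; case: ifPn => Pi; last first.
  by apply: eq_bexp => X _; rewrite big_cons (negPf Pi).
by rewrite -bexpD; apply: eq_bexp => X _; rewrite big_cons Pi.
Qed.

Lemma bexp_ge0 s f : (forall X, 0 <= f X) -> 0 <= bexp p s f.
Proof. by move=> f0; rewrite -(bexp_cst s 0); apply: ler_bexp. Qed.

(** First moment method: were all values below the mean, their convex combination would be too. *)
Lemma bexp_witness s f : exists2 X, {subset X <= s} & bexp p s f <= f X.
Proof.
apply: contrapT => nX.
have lt_s X : {subset X <= s} -> f X < bexp p s f.
  by move=> Xs; rewrite ltNge; apply/negP => fX; apply: nX; exists X.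
suff: bexp p s f < bexp p s f by rewrite ltxx.
(* The bound becomes a fixed [c], since the induction changes [f] and hence the mean. *)
move: {-2}(bexp p s f) lt_s => c; elim: s {nX} f => [|x s IH] f fc /=; first exact: fc.
have h1 : bexp p s (fun X => f (x :: X)) < c.
  apply: IH => X Xs; apply: fc => y.
  by rewrite !inE => /orP[->//|/Xs ->]; rewrite orbT.
have h2 : bexp p s f < c.
  by apply: IH => X Xs; apply: fc => y /Xs; rewrite inE => ->; rewrite orbT.
have [p00|pn0] := eqVneq p 0; first by move: h2; rewrite p00 mul0r add0r subr0 mul1r.
rewrite (_ : c = p * c + (1 - p) * c); last by ring.
apply: ltr_leD; last by apply: ler_wpM2l => //; exact: ltW.
by rewrite ltr_pM2l // lt0r pn0.
Qed.

Lemma bexp_avoid s (P : pred T) :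
  bexp p s (fun X => (~~ has P X)%:R) = (1 - p) ^+ count P s.
Proof.
elim: s => [|x s IH] /=; first by rewrite expr0.
case: (boolP (P x)) => Px /=.
  by rewrite bexp_cst mulr0 add0r IH -exprS.
by rewrite IH; ring.
Qed.

(** Independence: [g] does not see whether [x] is kept. *)
Lemma bexp_mem s x g : uniq s -> x \in s ->
  (forall X Y, g (X ++ x :: Y) = g (X ++ Y)) ->
  bexp p s (fun X => (x \in X)%:R * g X) = p * bexp p s g.
Proof.
elim: s g => [//|y s IH] g /= /andP[ys us]; rewrite inE => xs gx.
have [xy|xy] := eqVneq x y; last first.
  have {}xs : x \in s by move: xs; rewrite (negPf xy).
  rewrite (_ : bexp p s (fun X => (x \in y :: X)%:R * g (y :: X)) =
               p * bexp p s (fun X => g (y :: X))); last first.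
    rewrite -IH //; last by move=> X Y; exact: (gx (y :: X)).
    by apply: eq_bexp => X _; rewrite inE (negPf xy).
  by rewrite IH //; ring.
subst y; rewrite [X in _ + (1 - p) * X](_ : _ = 0); last first.
  rewrite -(bexp_cst s 0); apply: eq_bexp => X Xs.
  by rewrite (negPf (contra (Xs x) ys)) mul0r.
have -> : bexp p s (fun X => (x \in x :: X)%:R * g (x :: X)) = bexp p s g.
  by apply: eq_bexp => X _; rewrite mem_head mul1r; exact: (gx [::]).
have -> : bexp p s (fun X => g (x :: X)) = bexp p s g.
  by apply: eq_bexp => X _; exact: (gx [::]).
ring.
Qed.

Lemma expRN_le (x : R) : 0 <= x -> expR (- x) <= 1 - x + x ^+ 2.
Proof.
move=> x0; rewrite expRN -[leLHS]mul1r ler_pdivrMr ?expR_gt0 //.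
have := expR_ge1Dx x => h.
have : (1 - x + x ^+ 2) * (1 + x) <= (1 - x + x ^+ 2) * expR x.
  by apply: ler_wpM2l => //; nra.
apply: le_trans; rewrite (_ : _ * _ = 1 + x ^+ 3); last by ring.
by rewrite lerDl exprn_ge0.
Qed.

(* Only the second moment of the increments enters, not their maximum, because
   for a decreasing function the upper tail is the benign one. *)
Lemma bexp_expR_antitone s f (c : T -> R) (l : R) : 0 <= l ->
  (forall x X Y, 0 <= f (X ++ Y) - f (X ++ x :: Y) <= c x) ->
  bexp p s (fun X => expR (l * f X)) <=
  expR (l * bexp p s f + l ^+ 2 * (p * \sum_(x <- s) c x ^+ 2)).
Proof.
move=> l0; elim: s f => [|x s IH] f fc /=.
  by rewrite big_nil !mulr0 addr0.
rewrite big_cons; set S := \sum_(_ <- _) _.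
(* [a] and [b] are the conditional means given that [x] is kept or dropped. *)
set b := bexp p s f; set a := bexp p s (fun X => f (x :: X)).
have h1 := IH (fun X => f (x :: X)) (fun y X Y => fc y (x :: X) Y).
have h2 := IH f fc.
have /andP[ab0 abc] : 0 <= b - a <= c x.
  rewrite /a /b -bexpB; apply/andP; split.
    by apply: bexp_ge0 => X; have /andP[] := fc x [::] X.
  rewrite -[c x](bexp_cst s); apply: ler_bexp => X _.
  by have /andP[] := fc x [::] X.
rewrite -/S in h1 h2; rewrite -/a in h1; rewrite -/b in h2.
apply: (le_trans (lerD (ler_wpM2l p0 h1) (ler_wpM2l q0 h2))).
rewrite !expRD; set E := expR (_ * (_ * S)).
have -> : l * a = l * b + - (l * (b - a)) by ring.
rewrite expRD; set F := expR (l * b); set u := l * (b - a).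
have u0 : 0 <= u by rewrite mulr_ge0.
have := expRN_le u0; set e := expR _ => he.
have -> : expR (l * (p * a + (1 - p) * b)) = F * expR (- (p * u)).
  by rewrite /F -expRD; congr expR; rewrite /u; ring.
have -> : expR (l ^+ 2 * (p * (c x ^+ 2 + S))) = expR (l ^+ 2 * (p * c x ^+ 2)) * E.
  by rewrite /E -expRD; congr expR; ring.
have -> : p * (F * e * E) + (1 - p) * (F * E) = F * (1 + p * (e - 1)) * E by ring.
have -> : F * expR (- (p * u)) * (expR (l ^+ 2 * (p * c x ^+ 2)) * E) =
  F * (expR (- (p * u) + l ^+ 2 * (p * c x ^+ 2))) * E by rewrite expRD; ring.
apply: ler_wpM2r; first exact: expR_ge0.
apply: ler_wpM2l; first exact: expR_ge0.
(* It remains to compare exponents, by [e - 1 <= - u + u ^ 2] and [u <= l * c x]. *)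
apply: (le_trans (expR_ge1Dx _)); rewrite ler_expR.
have : u ^+ 2 <= l ^+ 2 * c x ^+ 2.
  rewrite /u exprMn; apply: ler_wpM2l; first exact: exprn_ge0.
  by rewrite ler_pXn2r // nnegrE; apply: le_trans abc.
move=> uc; have -> : l ^+ 2 * (p * c x ^+ 2) = p * (l ^+ 2 * c x ^+ 2) by ring.
have : p * (e - 1) <= p * (- u + u ^+ 2) by apply: ler_wpM2l => //; lra.
have := ler_wpM2l p0 uc; lra.
Qed.

Lemma bexp_markov s f (l M : R) : 0 <= l ->
  bexp p s (fun X => (M <= f X)%R%:R) <=
  expR (- (l * M)) * bexp p s (fun X => expR (l * f X)).
Proof.
move=> l0; rewrite -bexpZ; apply: ler_bexp => X _.
have [h|_] := boolP (M <= f X); last by apply: mulr_ge0; apply: expR_ge0.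
rewrite -expRD /= -[X in X <= _]expR0 ler_expR.
have := ler_wpM2l l0 h; lra.
Qed.

Lemma bexp_upper_tail_antitone s f (c : T -> R) (t V M : R) :
  (forall x X Y, 0 <= f (X ++ Y) - f (X ++ x :: Y) <= c x) ->
  0 <= t -> 0 < V -> p * \sum_(x <- s) c x ^+ 2 <= V -> bexp p s f + t <= M ->
  bexp p s (fun X => (M <= f X)%R%:R) <= expR (- (t ^+ 2 / (4 * V))).
Proof.
(* This [l] minimises [l ^ 2 * V - l * t]. *)
move=> fc t0 V0 cV tM; set l := t / (2 * V).
have l0 : 0 <= l by rewrite divr_ge0 // mulr_ge0 // ltW.
apply: (le_trans (bexp_markov s f M l0)).
apply: (le_trans (ler_wpM2l (expR_ge0 _) (bexp_expR_antitone s l0 fc))).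
rewrite -expRD ler_expR.
have h1 := ler_wpM2l l0 tM.
have h2 := ler_wpM2l (exprn_ge0 2 l0) cV.
have -> : t ^+ 2 / (4 * V) = l * t - l ^+ 2 * V.
  by rewrite /l; field; rewrite gt_eqF.
lra.
Qed.

Lemma bexp_expR_count s (P : pred T) (a : R) :
  bexp p s (fun X => expR (a * (count P X)%:R)) =
  (1 + p * (expR a - 1)) ^+ count P s.
Proof.
elim: s => [|x s IH] /=; first by rewrite mulr0 expR0.
case: (boolP (P x)) => Px /=; last first.
  rewrite add0n -IH; set b := bexp _ _ _; ring.
under eq_bexp do rewrite natrD mulrDr mulr1 expRD.
by rewrite bexpZ IH add1n exprS; ring.
Qed.

(** Chernoff bound with the parameter [a] left to the caller: it serves once for a deviation that is
    a small fraction of the mean and once for one equal to the mean bound. *)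
Lemma bexp_upper_tail_count s (P : pred T) (t mu a : R) :
  0 <= a <= 2^-1 -> p * (count P s)%:R <= mu ->
  bexp p s (fun X => (mu + t <= (count P X)%:R)%R%:R) <=
  expR (- (a * t) + 2 * a ^+ 2 * mu).
Proof.
move=> /andP[a0 a1] hmu.
apply: (le_trans (bexp_markov s (fun X => (count P X)%:R) _ a0)).
rewrite bexp_expR_count.
have ea : expR a <= 1 + a + 2 * a ^+ 2.
  have e0 := expR_gt0 a.
  have := expR_ge1Dx (- a); rewrite expRN => h'.
  have hh : (1 - a) * expR a <= 1 by rewrite -ler_pdivlMr // mul1r.
  (* The product on the right is [1 + a ^ 2 * (1 - 2 * a)], at least 1 because [a <= 1/2]. *)
  have : (1 - a) * expR a <= (1 - a) * (1 + a + 2 * a ^+ 2) by nra.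
  by rewrite ler_pM2l //; lra.
have ea1 : 0 <= expR a - 1 by rewrite subr_ge0 -expR0 ler_expR.
have : (1 + p * (expR a - 1)) ^+ count P s <= expR (a * mu + 2 * a ^+ 2 * mu).
  apply: (@le_trans _ _ (expR (p * (expR a - 1)) ^+ count P s)).
    by apply: lerXn2r; rewrite ?nnegrE ?expR_ge0 ?expR_ge1Dx // addr_ge0 // mulr_ge0.
  rewrite -expRM_natl ler_expR.
  have -> : (count P s)%:R * (p * (expR a - 1)) = (p * (count P s)%:R) * (expR a - 1) by ring.
  apply: (@le_trans _ _ (mu * (expR a - 1))); first exact: ler_wpM2r.
  have mu0 : 0 <= mu by apply: le_trans hmu; rewrite mulr_ge0.
  rewrite -mulrDl mulrC ler_wpM2r //; lra.
move=> h; apply: (le_trans (ler_wpM2l (expR_ge0 _) h)).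
by rewrite -expRD ler_expR; lra.
Qed.
End Bernoulli.

(** * Independent sets in graphs with small codegrees *)

Section Graph.
Variables (R : realType) (T : finType) (e : rel T).
Implicit Types (A B C I : pred T) (v w u : T).

Definition nbr A v : pred T := [pred w | A w && e v w].

Definition sparse A (D : nat) (K : R) : Prop :=
  (forall v, A v -> #|nbr A v| <= D)%N /\
  (forall u v, A u -> A v -> u != v -> #|[predI nbr A u & nbr A v]|%:R <= K).

Definition has_indep A (c : R) : Prop := exists I : pred T,
  [/\ forall v, I v -> A v, forall u v, I u -> I v -> ~~ e u v
    & c * #|A|%:R <= #|I|%:R].

Lemma natr_card (U : finType) (P : pred U) : #|P|%:R = \sum_x (P x)%:R :> R.
Proof.
rewrite -sum1_card natr_sum big_mkcond; apply: eq_bigr => x _.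
by rewrite unfold_in; case: (P x).
Qed.

Variable D : nat.
Local Notation U := (T + T * 'I_D)%type.

(* Private dummy elements [inr (w, j)] pad the neighbourhood of [w] to exactly
   [D] elements, so that all vertices survive with the same probability. *)
Definition hit A w : pred U := fun x =>
  match x with
  | inl u => nbr A w u
  | inr z => (z.1 == w) && (z.2 < D - #|nbr A w|)%N
  end.

Lemma card_hit A w : (#|nbr A w| <= D)%N -> #|hit A w| = D.
Proof.
move=> wD; rewrite -sum1_card big_sumType /= (eq_bigl (nbr A w)) //.
rewrite sum1_card (eq_bigl (fun z : T * 'I_D => (z.1 == w) && (z.2 < D - #|nbr A w|)%N)) //.
rewrite -(pair_big (fun z => z == w) (fun j : 'I_D => (j < D - #|nbr A w|)%N) (fun _ _ => 1%N)) /=.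
rewrite big_pred1_eq.
have kD : (D - #|nbr A w| <= D)%N by exact: leq_subr.
by rewrite (big_ord_narrow kD) /= sum1_card card_ord subnKC.
Qed.

(** Dummies are private, so padding creates no new common elements. *)
Lemma card_hitI A w w' : w != w' ->
  #|[predI hit A w & hit A w']| = #|[predI nbr A w & nbr A w']|.
Proof.
move=> ww'; rewrite -!sum1_card big_sumType /= [X in (_ + X)%N]big_pred0 ?addn0 //.
move=> [z j]; rewrite !inE /=; apply/negP => /andP[/andP[/eqP zw _] /andP[/eqP zw' _]].
by move: ww'; rewrite -zw -zw' eqxx.
Qed.

(** Whether [w] itself is picked is left open: picked alive vertices enter the independent set,
    unpicked ones go on to the next round. *)
Definition alive A (X : seq U) w := ~~ has (hit A w) X.

(** Expanding the square counts pairs [(w, w')] with a common element: the diagonal gives [D] per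
    vertex, the other pairs at most [K] each. *)
Lemma sum_hit_sqr A (C : pred T) (K : R) : 0 <= K -> sparse A D K ->
  (forall v, C v -> A v) ->
  \sum_(x <- enum {: U}) (\sum_(w | C w) (hit A w x)%:R) ^+ 2
  <= #|C|%:R * D%:R + #|C|%:R ^+ 2 * K.
Proof.
move=> K0 [degA codA] CA; rewrite big_enum /=.
have sqE (x : U) : (\sum_(w | C w) (hit A w x)%:R) ^+ 2 =
    \sum_(w | C w) \sum_(w' | C w') (hit A w x)%:R * (hit A w' x)%:R :> R.
  by rewrite expr2 mulr_suml; apply: eq_bigr => w _; rewrite mulr_sumr.
rewrite (eq_bigr _ (fun x _ => sqE x)) exchange_big /=.
under eq_bigr => w _ do rewrite exchange_big /=.
have -> : #|C|%:R * D%:R + #|C|%:R ^+ 2 * K =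
          \sum_(w | C w) (D%:R + \sum_(w' | C w') K).
  rewrite big_split /= !sumr_const -(mulr_natr D%:R) -(mulr_natr K) -(mulr_natr (K * _)); ring.
apply: ler_sum => w Cw.
have cardE w' : \sum_x ((hit A w x)%:R * (hit A w' x)%:R) =
   #|[predI hit A w & hit A w']|%:R :> R.
  by rewrite natr_card; apply: eq_bigr => x _; rewrite -natrM mulnb.
under eq_bigr => w' _ do rewrite cardE.
rewrite (bigD1 w) //=; apply: lerD.
  have -> : #|[predI hit A w & hit A w]| = #|hit A w|.
    by apply: eq_card => x; rewrite !inE andbb.
  by rewrite card_hit // degA // CA.
rewrite [leRHS](bigD1 w) //= ler_wpDl //.
apply: ler_sum => w' /andP[Cw' ww'].
by rewrite card_hitI 1?eq_sym // codA // ?CA // eq_sym.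
Qed.

(** The number of survivors in [C] decreases as [X] grows, and [x] kills at most the [w] whose [hit]
    set contains it. The padding makes the mean exactly [#|C| * (1 - p) ^ D]. *)
Lemma alive_tail A C (K p M dl : R) : 0 <= K -> sparse A D K ->
  (forall v, C v -> A v) -> 0 < p <= 1 -> #|C|%:R <= M -> 0 < M -> 0 < dl ->
  (0 < D)%N ->
  bexp p (enum {: U}) (fun X => (M * ((1 - p) ^+ D + dl) <=
                        \sum_(w | C w) (alive A X w)%:R)%R%:R) <=
  expR (- (dl ^+ 2 / (4 * (p * (D%:R / M + K))))).
Proof.
move=> K0 sA CA /andP[p0 p1] CM M0 dl0 D0.
have p01 : 0 <= p <= 1 by rewrite ltW.
set V := p * (M * D%:R + M ^+ 2 * K).
have V0 : 0 < V.
  by rewrite mulr_gt0 // ltr_pwDl // ?mulr_gt0 ?ltr0n // mulr_ge0 // ?exprn_ge0 // ltW.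
have -> : dl ^+ 2 / (4 * (p * (D%:R / M + K))) = (dl * M) ^+ 2 / (4 * V).
  have DK : 0 < D%:R / M + K by rewrite ltr_pwDl // divr_gt0 ?ltr0n.
  have : D%:R + K * M != 0 by rewrite gt_eqF // ltr_pwDl ?ltr0n // mulr_ge0 // ltW.
  have : M * D%:R + M ^+ 2 * K != 0.
    by rewrite gt_eqF // ltr_pwDl // ?mulr_gt0 ?ltr0n // mulr_ge0 // ?exprn_ge0 // ltW.
  by rewrite /V => h1 h2; field; rewrite h1 h2 (gt_eqF p0) (gt_eqF M0).
apply: (@bexp_upper_tail_antitone R U p p01 (enum {: U}) _
          (fun x => \sum_(w | C w) (hit A w x)%:R)) => //.
- move=> x X Y; rewrite -sumrB; apply/andP; split; last first.
    apply: ler_sum => w _; rewrite /alive !has_cat /=.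
    by case: (has _ X); case: (hit _ _ x); case: (has _ Y) => /=; rewrite ?subrr ?subr0.
  apply: sumr_ge0 => w _; rewrite /alive !has_cat /=.
  by case: (has _ X); case: (hit _ _ x); case: (has _ Y) => /=; rewrite ?subrr ?subr0.
- by rewrite mulr_ge0 // ltW.
- apply: ler_wpM2l; first exact: ltW.
  apply: (le_trans (sum_hit_sqr K0 sA CA)).
  apply: lerD; first by rewrite ler_wpM2r.
  by rewrite ler_wpM2r // lerXn2r // nnegrE ?ler0n // ltW.
- rewrite bexp_sum (eq_bigr (fun=> (1 - p) ^+ D)); last first.
    move=> w Cw; rewrite /alive bexp_avoid; congr (_ ^+ _).
    by rewrite enumT -size_filter -[RHS](card_hit (sA.1 w (CA _ Cw))) cardE.
  rewrite sumr_const -mulr_natl mulrDr [M * dl]mulrC lerD2r.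
  by rewrite ler_wpM2r // exprn_ge0 // subr_ge0.
Qed.
End Graph.

(** * One round of the nibble *)

Section Nibble.
Variables (R : realType) (T : finType) (e : rel T).
Hypotheses (e_sym : symmetric e) (e_irr : irreflexive e).
Implicit Types (A B C I : pred T) (v w u : T).

Local Notation nbr := (nbr e).
Local Notation has_indep := (has_indep e).

(** Such a [u] ends a path of length two from [w]; the count goes by the middle vertex. It limits
    the codegree events in the union bound. *)
Lemma card_codeg_vertices A D w : (forall v, A v -> #|nbr A v| <= D)%N -> A w ->
  (#|[pred u | A u && [exists x, nbr A u x && nbr A w x]]| <= D * D)%N.
Proof.
move=> degA Aw; rewrite -sum1_card.
apply: (@leq_trans (\sum_(u | A u) \sum_(x | nbr A w x) e u x)%N).
  rewrite big_mkcond [leqRHS]big_mkcond /=; apply: leq_sum => u _.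
  rewrite inE; case: (A u) => //=.
  case: ifPn => // /existsP[x /andP[/andP[_ ux] wx]].
  by rewrite (bigD1 x) //= ux.
rewrite exchange_big /=.
apply: (@leq_trans (\sum_(x | nbr A w x) D)%N); last first.
  by rewrite sum_nat_const leq_mul2r degA // orbT.
apply: leq_sum => x /andP[Ax _].
apply: leq_trans (degA x Ax); rewrite -sum1_card big_mkcond [leqRHS]big_mkcond /=.
by apply: leq_sum => u _; rewrite inE e_sym; case: (A u); case: (e x u).
Qed.

(** Vertices and dummies are picked with probability [g / D]. Picked alive vertices form [I X];
    unpicked alive ones, minus the few whose degree or codegree stayed too large, form [B X], to
    which the assumption on [D'] applies. An [X] for which [#|I X| + c * #|B X|] is at least its
    mean gives the density. *)
Lemma nibble_step A (D D' : nat) (eps g dl c : R) :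
  0 < g <= 1 -> 0 < dl -> 0 < eps <= 1 -> 1 <= eps ^+ 2 * D%:R -> 0 <= c ->
  D%:R * (expR (- g) + dl) <= D'%:R ->
  sparse e A D (eps * D%:R) ->
  (forall B, sparse e B D' (eps * D'%:R) -> has_indep B c) ->
  has_indep A (g / D%:R * (1 - g / D%:R) ^+ D +
    c * ((1 - g / D%:R) ^+ D.+1 -
         (1 + (D * D)%:R) * expR (- (dl ^+ 2 / (8 * g * eps))))).
Proof.
move=> /andP[g0 g1] dl0 /andP[eps0 eps1] epsD c0 DD' sA IH.
have D0 : (0 < D)%N by case: D epsD {sA DD'} => //; rewrite mulr0; lra.
have D1 : 1 <= D%:R :> R by rewrite ler1n.
have DR : 0 < D%:R :> R by rewrite ltr0n.
set p := g / D%:R.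
have p0 : 0 < p by rewrite divr_gt0.
have p1 : p <= 1 by rewrite ler_pdivrMr // mul1r (le_trans g1).
have p01 : 0 <= p <= 1 by rewrite ltW.
have pp : 0 < p <= 1 by rewrite p0.
have pD : p * D%:R = g by rewrite /p divfK // gt_eqF.
set K := eps * D%:R; have K1 : 1 <= K.
  apply: (le_trans epsD); rewrite /K expr2 -mulrA ler_piMl // mulr_ge0 // ltW //.
have K0 : 0 < K by apply: lt_le_trans K1.
set q := (1 - p) ^+ D; set b := expR _.
have q0 : 0 <= q by rewrite exprn_ge0 // subr_ge0.
have qg : q <= expR (- g).
  have -> : - g = D%:R * (- p) by rewrite -pD; ring.
  rewrite expRM_natl; apply: lerXn2r; rewrite ?nnegrE ?expR_ge0 ?subr_ge0 //.
  exact: expR_ge1Dx.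
set F := fun (C : pred T) X => \sum_(w | C w) (alive (D := D) e A X w)%:R : R.
(* Applied with [M = D] for neighbourhoods and [M = K] for common neighbourhoods. In both cases
   [D / M <= K], in the second because [eps ^ 2 * D >= 1]. *)
have tailC C (M : R) : (forall v, C v -> A v) -> #|C|%:R <= M -> 0 < M ->
    D%:R / M + K <= 2 * K ->
    bexp p (enum {: T + T * 'I_D}) (fun X => (M * (q + dl) <= F C X)%R%:R) <= b.
  move=> CA CM M0 MK.
  apply: (le_trans (@alive_tail R T e D A C K p M dl (ltW K0) sA CA pp CM M0 dl0 D0)).
  rewrite /b ler_expR lerN2 ler_wpM2l ?exprn_ge0 ?(ltW dl0) //.
  have h : 0 < D%:R / M + K by rewrite addr_gt0 // divr_gt0.
  have h4 : 0 < 4 * (p * (D%:R / M + K)) by apply: mulr_gt0 => //; apply: mulr_gt0.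
  have h8 : 0 < 8 * g * eps by apply: mulr_gt0 => //; apply: mulr_gt0.
  rewrite lef_pV2 ?posrE //.
  rewrite (_ : 8 * g * eps = 4 * (p * (2 * K))); last by rewrite -pD /K; ring.
  by rewrite ler_pM2l // ler_pM2l.
(* [F] counts alive vertices, picked or not, and [u] ranges over all of [A], so vertices that are
   not bad have controlled degrees and codegrees inside [B X]. *)
set bad := fun X w => (D%:R * (q + dl) <= F (nbr A w) X) ||
  [exists u, [&& A u, u != w & K * (q + dl) <= F [predI nbr A u & nbr A w] X]].
have Ebad w : A w ->
    bexp p (enum {: T + T * 'I_D}) (fun X => (bad X w)%:R) <= (1 + (D * D)%:R) * b.
  move=> Aw; set Q := fun u => [&& A u, u != w & [exists x, nbr A u x && nbr A w x]].
  apply: (@le_trans _ _ (bexp p (enum {: T + T * 'I_D})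
    (fun X => (D%:R * (q + dl) <= F (nbr A w) X)%R%:R +
      \sum_(u | Q u) (K * (q + dl) <= F [predI nbr A u & nbr A w] X)%R%:R))).
    apply: ler_bexp => // X _; rewrite /bad.
    case: (D%:R * (q + dl) <= F (nbr A w) X) => /=.
      by rewrite lerDl sumr_ge0.
    rewrite add0r; case: existsP => [[u /and3P[Au uw hu]]|_]; last by rewrite sumr_ge0.
    (* Without a common neighbour the count is 0, below the positive threshold. *)
    have Qu : Q u.
      rewrite /Q Au uw /=; apply: contraT; rewrite negb_exists => /forallP nex.
      move: hu; rewrite /F big_pred0; last by move=> x; apply/negbTE/nex.
      by rewrite leNgt mulr_gt0 // ltr_wpDl.
    by rewrite (bigD1 u) //= hu lerDl sumr_ge0.
  rewrite bexpD bexp_sum mulrDl mul1r; apply: lerD.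
    apply: tailC => //; first by move=> v /andP[].
      by rewrite ler_nat sA.1.
    rewrite divff ?gt_eqF //; lra.
  apply: (@le_trans _ _ (\sum_(u | Q u) b)).
    apply: ler_sum => u /and3P[Au uw _]; apply: tailC => //.
    - by move=> v /andP[/andP[]].
    - exact: sA.2.
    rewrite (_ : 2 * K = K + K); last by ring.
    rewrite lerD2r ler_pdivrMr // /K; move: epsD; rewrite expr2 => h.
    have := ler_wpM2r (ltW DR) h; lra.
  rewrite sumr_const -(mulr_natl b) ler_wpM2r ?expR_ge0 // ler_nat.
  apply: leq_trans (card_codeg_vertices sA.1 Aw).
  by apply: subset_leq_card; apply/fintype.subsetP => u; rewrite !inE => /and3P[-> _ ->].
set I := fun X : seq (T + T * 'I_D) => [pred w | [&& A w, inl w \in X & alive e A X w]].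
set B := fun X : seq (T + T * 'I_D) =>
  [pred w | [&& A w, inl w \notin X, alive e A X w & ~~ bad X w]].
have [X _ XE] := bexp_witness p01 (enum {: T + T * 'I_D})
   (fun X => #|I X|%:R + c * #|B X|%:R).
have sB : sparse e (B X) D' (eps * D'%:R).
  have BA w : B X w -> A w by case/and4P.
  have le_F C C' : (forall w, C' w -> C w && B X w) -> #|C'|%:R <= F C X.
    move=> CC; rewrite natr_card [leRHS]big_mkcond /=; apply: ler_sum => w _.
    have [/CC/andP[-> /and4P[_ _ -> _]]//|_] := boolP (C' w).
    by case: (C w).
  split=> [v|u v].
    move=> /[dup] Bv /and4P[Av _ _]; rewrite /bad negb_or -ltNge => /andP[hv _].
    rewrite -(ler_nat R); apply: le_trans DD'.
    apply: (@le_trans _ _ (D%:R * (q + dl))); last by rewrite ler_pM2l // lerD2r.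
    apply: le_trans (ltW hv); apply: le_F => w /andP[Bw vw].
    by rewrite Bw andbT /nbr /= vw BA.
  move=> /[dup] Bu /and4P[Au _ _ _] /[dup] Bv /and4P[Av _ _].
  rewrite /bad negb_or negb_exists => /andP[_ /forallP /(_ u)].
  rewrite Au /= => + uv; rewrite uv /= -ltNge => hv.
  apply: (@le_trans _ _ (K * (q + dl))).
    apply: le_trans (ltW hv); apply: le_F => w /andP[/andP[Bw uw] /andP[_ vw]].
    by rewrite Bw andbT /= !inE vw uw BA.
  rewrite /K -mulrA ler_pM2l //; apply: le_trans DD'.
  by rewrite ler_pM2l // lerD2r.
have [J [JB Jind Jcard]] := IH _ sB.
exists [predU I X & J]; split.
- by move=> v /orP[/and3P[]//|/JB/and4P[]].
(* An alive vertex has no picked neighbour, so no edge lies inside [I X] or joins it to [J]. *)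
- have ndead u v : I X u -> alive e A X v -> A v -> ~~ e v u.
    move=> /and3P[Au uX _] /hasPn /(_ _ uX) /=; rewrite /nbr /= Au /=.
    by [].
  move=> u v /orP[Iu|Ju] /orP[Iv|Jv].
  + by rewrite (ndead v u) //; case/and3P: Iu.
  + by rewrite e_sym (ndead u v) //; case/and4P: (JB _ Jv).
  + by rewrite (ndead v u) //; case/and4P: (JB _ Ju).
  + exact: Jind.
have -> : #|[predU I X & J]|%:R = #|I X|%:R + #|J|%:R :> R.
  rewrite -natrD -cardUI [X in (_ + X)%N](_ : _ = 0%N) ?addn0 //.
  apply: eq_card0 => w; rewrite !inE; apply/negbTE/negP => /andP[/and3P[_ wX _]].
  by move=> /JB/and4P[_]; rewrite wX.
apply: le_trans (lerD (lexx _) Jcard); apply: le_trans XE.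
rewrite bexpD bexpZ.
have countE (P : pred (T + T * 'I_D)) : count P (enum {: T + T * 'I_D}) = #|P|.
  by rewrite enumT -size_filter cardE.
rewrite mulrDl -mulrA -mulrA.
have -> : #|A|%:R = \sum_(w | A w) 1 :> R by rewrite sumr_const.
rewrite !mulr_sumr; apply: lerD.
  have -> : bexp p (enum {: T + T * 'I_D}) (fun X => #|I X|%:R) =
    \sum_(w | A w) bexp p (enum {: T + T * 'I_D}) (fun X =>
       (inl w \in X)%:R * (alive e A X w)%:R).
    rewrite -bexp_sum; apply: eq_bexp => // Y _; rewrite natr_card [RHS]big_mkcond /=.
    apply: eq_bigr => w _; case: (A w) => //=.
    by case: (inl w \in Y); case: (alive _ _ _ _); rewrite ?mulr0 ?mulr1.
  (* [w] is not in its own [hit] set, so being picked and being alive are independent. *)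
  apply: ler_sum => w Aw; rewrite bexp_mem ?enum_uniq ?mem_enum //; last first.
    by move=> Y Z; rewrite /alive !has_cat /= /nbr /= e_irr andbF.
  by rewrite /alive bexp_avoid // countE card_hit ?sA.1 // mulr1.
have -> : bexp p (enum {: T + T * 'I_D}) (fun X => #|B X|%:R) =
    \sum_(w | A w) bexp p (enum {: T + T * 'I_D}) (fun X =>
       [&& inl w \notin X, alive e A X w & ~~ bad X w]%:R).
  rewrite -bexp_sum; apply: eq_bexp => // Y _; rewrite natr_card [RHS]big_mkcond /=.
  by apply: eq_bigr => w _; case: (A w).
rewrite mulr_sumr; apply: ler_sum => w Aw; rewrite mulr1 ler_wpM2l //.
(* Unpicked and alive means that [X] avoids the [D + 1] elements formed by [w] and its [hit] set;
   bad outcomes are subtracted. *)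
apply: (@le_trans _ _ (bexp p (enum {: T + T * 'I_D}) (fun X =>
  (~~ has (predU1 (inl w) (hit e A w)) X)%:R - (bad X w)%:R))); last first.
  apply: ler_bexp => // Y _; rewrite /alive.
  have -> : has (predU1 (inl w) (hit e A w)) Y = (inl w \in Y) || has (hit e A w) Y.
    by rewrite -has_pred1 -has_predU; apply: eq_has.
  rewrite negb_or.
  case: (inl w \in Y); case: (has _ Y); case: (bad Y w) => /=;
    by rewrite ?subrr ?subr0 ?sub0r ?lerN10 ?oppr0.
rewrite bexpB bexp_avoid // countE lerB ?Ebad //.
have -> // : #|predU1 (inl w) (hit (D := D) e A w)| = D.+1.
rewrite cardU1 card_hit ?sA.1 // (_ : inl w \notin _) //.
by apply/negP => /andP[_]; rewrite e_irr.
Qed.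
End Nibble.

(** * Iteration of the nibble *)

Section NibbleIteration.
Variables (R : realType) (T : finType) (e : rel T).
Hypotheses (e_sym : symmetric e) (e_irr : irreflexive e).
Implicit Types (A B : pred T).

Lemma has_indep_le A (c c' : R) : c <= c' -> has_indep e A c' -> has_indep e A c.
Proof.
move=> cc' [I [IA Ii Ic]]; exists I; split => //.
by apply: le_trans Ic; rewrite ler_wpM2r.
Qed.

Lemma natr_truncnS (x : R) : 0 <= x -> x <= (Num.truncn x).+1%:R <= x + 1.
Proof.
move=> x0; have /andP[h1 h2] := truncn_itv x0.
by rewrite (ltW h2) /= -natr1 lerD2r.
Qed.

Lemma bernoulli_ineq (p : R) (n : nat) : 0 <= p <= 1 -> 1 - n%:R * p <= (1 - p) ^+ n.
Proof.
move=> /andP[p0 p1]; elim: n => [|n IH]; first by rewrite mul0r subr0 expr0.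
rewrite exprS -natr1; apply: le_trans (ler_wpM2l _ IH); last by lra.
have : 0 <= n%:R :> R by []; nra.
Qed.

Lemma survival_ge (g dl : R) (D : nat) : 0 < g <= 2^-1 -> 0 < dl -> 1 <= dl * D%:R ->
  (2 <= D)%N -> expR (- g) * (1 - 4 * dl) <= (1 - g / D%:R) ^+ D.+1.
Proof.
move=> /andP[g0 g1] dl0 dlD D2.
have DR : 2 <= D%:R :> R by rewrite (ler_nat R 2).
have D0 : 0 < D%:R :> R by lra.
have Dg : 0 < D%:R - g by lra.
have p1 : 0 < 1 - g / D%:R by rewrite subr_gt0 ltr_pdivrMr // mul1r; lra.
(* From [1 - g / D = 1 / (1 + g / (D - g))]; the total exponent [(D + 1) * g / (D - g)] exceeds [g]
   by a multiple of [1 / D <= dl]. *)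
have lb : expR (- (g / (D%:R - g))) <= 1 - g / D%:R.
  have -> : 1 - g / D%:R = (1 + g / (D%:R - g))^-1.
    by field; rewrite (_ : D%:R - g + g = D%:R) ?gt_eqF //; ring.
  rewrite expRN lef_pV2 ?posrE ?expR_gt0 ?expR_ge1Dx //.
  by rewrite addr_gt0 // divr_gt0.
apply: (@le_trans _ _ (expR (- (g / (D%:R - g))) ^+ D.+1)); last first.
  by apply: lerXn2r; rewrite ?nnegrE ?expR_ge0 // ltW.
rewrite -expRM_natl.
apply: (@le_trans _ _ (expR (- g + - (4 * dl)))).
  by rewrite expRD ler_pM2l ?expR_gt0 // expR_ge1Dx.
rewrite ler_expR mulrN -opprD lerN2 mulrA ler_pdivrMr // -natr1.
nra.
Qed.

(** Set size and degree bound shrink by nearly the same factor [expR (- g)], so their quotient is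
    almost constant and each of the [k] rounds adds about [g * (1 - g) / D] relative to the initial
    set. A round costs the quotient a factor of at least [1 - 10 * dl]. The degree bound stays above
    [Dmin] throughout; [Dmax] enters the union bound. *)
Lemma nibble_iter (eps g dl Dmin Dmax : R) (k D : nat) A :
  0 < g <= 2^-1 -> 0 < dl -> expR (- g) + 2 * dl <= 1 ->
  0 < eps <= 1 -> 1 <= eps ^+ 2 * Dmin -> 1 <= dl * Dmin -> 2 <= Dmin ->
  (1 + Dmax ^+ 2) * expR (- (dl ^+ 2 / (8 * g * eps))) <= dl ->
  10 * dl * k%:R <= 1 ->
  Dmin * expR (g * k%:R) <= D%:R -> D%:R <= Dmax -> sparse e A D (eps * D%:R) ->
  has_indep e A (g * (1 - g) * k%:R * (1 - 10 * dl * k%:R) / D%:R).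
Proof.
move=> g01 dl0 gdl eps01 epsD dlD Dmin2 rare; have [g0 g1] := andP g01.
have Dm0 : 0 <= Dmin by lra.
have gg : 0 <= 1 - g by lra.
elim: k D A => [|k IH] D A.
  move=> _ _ _ _; exists pred0; split => //.
  by rewrite !(mulr0, mul0r) card0.
rewrite -[k.+1%:R]natr1 => dlk Dk DDmax sA.
set n : R := k%:R in IH dlk Dk *.
have n0 : 0 <= n by rewrite ler0n.
have E1 (x : R) : 0 <= x -> 1 <= expR x by move=> x0; rewrite -expR0 ler_expR.
have DminD : Dmin <= D%:R.
  have gn : 0 <= g * (n + 1) by apply: mulr_ge0; lra.
  apply: le_trans Dk; rewrite -[leLHS]mulr1 ler_wpM2l ?E1 //.
have DR : 2 <= D%:R :> R by lra.
have D0 : 0 < D%:R :> R by lra.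
have D2 : (2 <= D)%N by rewrite -(ler_nat R).
have dlD1 : 1 <= dl * D%:R by apply: le_trans dlD _; rewrite ler_pM2l.
have epsD1 : 1 <= eps ^+ 2 * D%:R.
  by apply: le_trans epsD _; rewrite ler_wpM2l // exprn_ge0 //; case/andP: eps01 => /ltW.
set y := D%:R * (expR (- g) + dl).
have y0 : 0 <= y by rewrite mulr_ge0 ?addr_ge0 ?expR_ge0 //; lra.
(* Rounding up costs at most 1, absorbed by [1 <= dl * D]. *)
set D' := (Num.truncn y).+1.
have /andP[yD' D'y] := natr_truncnS y0; rewrite -/D' in yD' D'y.
have D'D2 : D'%:R <= D%:R * (expR (- g) + 2 * dl).
  apply: (le_trans D'y); rewrite /y; lra.
have D'D : D'%:R <= D%:R :> R.
  apply: (le_trans D'D2); rewrite ler_piMr //; lra.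
have D'0 : 0 < D'%:R :> R by rewrite ltr0n.
have Dk' : Dmin * expR (g * n) <= D'%:R.
  apply: le_trans yD'; rewrite /y.
  apply: (@le_trans _ _ (D%:R * expR (- g))); last by rewrite ler_pM2l // lerDl ltW.
  rewrite -ler_pdivrMr ?expR_gt0 // -expRN opprK -mulrA -expRD.
  by apply: le_trans Dk; rewrite mulrDr mulr1.
have dln0 : 0 <= dl * n by rewrite mulr_ge0 // ltW.
have dlk' : 10 * dl * n <= 1 by lra.
have dlk0 : 0 <= 1 - 10 * dl * n by rewrite subr_ge0.
have c0 : 0 <= g * (1 - g) * n * (1 - 10 * dl * n) / D'%:R.
  by rewrite divr_ge0 ?(ltW D'0) // !mulr_ge0 // ltW.
have g011 : 0 < g <= 1 by rewrite g0 /=; lra.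
have := nibble_step e_sym e_irr g011 dl0 eps01 epsD1 c0 yD' sA
  (fun B => IH D' B dlk' Dk' (le_trans D'D DDmax)).
apply: has_indep_le.
set p := g / D%:R; set b := expR (- (_ / _)).
have p0 : 0 <= p by rewrite divr_ge0 // ltW.
have p1 : 0 <= 1 - p by rewrite subr_ge0 /p ler_pdivrMr //; lra.
have pD : 1 - g <= (1 - p) ^+ D.
  have gE : g = D%:R * p by rewrite /p mulrCA divff ?mulr1 // gt_eqF.
  by rewrite [X in 1 - X]gE; apply: bernoulli_ineq; lra.
have b0 : 0 <= b by exact: expR_ge0.
have err : (1 + (D * D)%:R) * b <= dl.
  apply: le_trans rare; rewrite ler_wpM2r // lerD2l natrM -expr2.
  by rewrite lerXn2r // nnegrE; lra.
have surv := survival_ge g01 dl0 dlD1 D2; rewrite -/p in surv.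
set E := expR (- g) in surv gdl D'D2 *.
have E12 : 2^-1 <= E by have := expR_ge1Dx (- g); rewrite -/E; lra.
set s := (1 - p) ^+ D.+1 in surv *.
set t := (1 - p) ^+ D in pD *.
set r := (1 + (D * D)%:R) * b in err *.
(* Of the loss [10 * dl], [4 * dl] comes from survival, [2 * dl] from bad vertices as [E >= 1/2],
   and [4 * dl] from the upper bound on [D']. *)
have ratio : (1 - 10 * dl) / D%:R <= (s - r) / D'%:R.
  rewrite ler_pdivrMr // mulrAC ler_pdivlMr //.
  have h1 : E * (1 - 6 * dl) <= s - r by nra.
  have h2 : D'%:R <= D%:R * (E * (1 + 4 * dl)).
    by apply: (le_trans D'D2); rewrite ler_pM2l //; nra.
  have d1 : 0 <= 1 - 10 * dl by nra.
  apply: (le_trans (ler_wpM2l d1 h2)).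
  apply: le_trans (ler_wpM2r (ltW D0) h1).
  have -> : (1 - 10 * dl) * (D%:R * (E * (1 + 4 * dl))) =
    D%:R * E * (1 - 6 * dl - 40 * dl ^+ 2) by ring.
  have -> : E * (1 - 6 * dl) * D%:R = D%:R * E * (1 - 6 * dl) by ring.
  rewrite ler_wpM2l ?mulr_ge0 ?expR_ge0 //; nra.
have w0 : 0 <= g * (1 - g) / D%:R by rewrite divr_ge0 // mulr_ge0 // ltW.
apply: (@le_trans _ _ (g * (1 - g) / D%:R *
    (1 + n * (1 - 10 * dl * n) * (1 - 10 * dl)))).
  have -> : g * (1 - g) * (n + 1) * (1 - 10 * dl * (n + 1)) / D%:R =
    g * (1 - g) / D%:R * ((n + 1) * (1 - 10 * dl * (n + 1))) by ring.
  apply: ler_wpM2l => //; rewrite -subr_ge0.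
  have -> : 1 + n * (1 - 10 * dl * n) * (1 - 10 * dl) -
     (n + 1) * (1 - 10 * dl * (n + 1)) = 10 * dl + 10 * (dl * n) + (10 * (dl * n)) ^+ 2 by ring.
  by rewrite addr_ge0 ?sqr_ge0 //; lra.
rewrite mulrDr mulr1; apply: lerD.
  by rewrite /p mulrAC ler_wpM2l // divr_ge0 // ltW.
have -> : g * (1 - g) * n * (1 - 10 * dl * n) / D'%:R * (s - r) =
  g * (1 - g) * n * (1 - 10 * dl * n) * ((s - r) / D'%:R) by ring.
have -> : g * (1 - g) / D%:R * (n * (1 - 10 * dl * n) * (1 - 10 * dl)) =
  g * (1 - g) * n * (1 - 10 * dl * n) * ((1 - 10 * dl) / D%:R) by ring.
by apply: ler_wpM2l ratio; rewrite !mulr_ge0 // ltW.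
Qed.
End NibbleIteration.

(** The nibble runs with [g = h] until the degree has fallen from [expR L] to about [expR (h * L)]:
    some [(1 - h) * L / h] rounds, each gaining about [h / D]. Stopping early and rounding lose
    [2 * h], the factor [1 - g] loses [h], and [dl] loses [h]. *)
Lemma indep_low_codegree (R : realType) (T : finType) (e : rel T) (h : R) (D : nat)
    (A : pred T) : symmetric e -> irreflexive e -> 0 < h <= 4^-1 -> (0 < D)%N ->
  10 ^+ 6 / h ^+ 9 <= ln (D%:R : R) ->
  sparse e A D (ln (D%:R : R) ^- 4 * D%:R) ->
  has_indep e A ((1 - 4 * h) * ln D%:R / D%:R).
Proof.
move=> e_sym e_irr /andP[h0 h4] D0 LD sA.
have DR : 0 < D%:R :> R by rewrite ltr0n.
set L : R := ln D%:R in LD sA *.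
(* The large constant is kept abstract for the arithmetic tactics. *)
have [c [cE c9 c0]] : exists c : R, [/\ c = 10 ^+ 6, 9`!%:R <= c & 32 * 100 <= c].
  exists (10 ^+ 6); split=> //; last lra.
  rewrite (_ : 9`! = (9 * (8 * (7 * 720)))%N) // !natrM.
  by rewrite (_ : 720%:R = 72 * 10 :> R) -?natrM //; lra.
rewrite -cE {cE} in LD.
have DE : D%:R = expR L by rewrite lnK.
have h1 : h <= 1 by lra.
have hX n : 0 < h ^+ n by rewrite exprn_gt0.
have LD' : c <= L * h ^+ 9 by rewrite -ler_pdivrMr.
have hX1 n : h ^+ n <= 1 by rewrite exprn_ile1 // ltW.
have L1 : c <= L.
  have L0 : 0 <= L by rewrite -(pmulr_lge0 _ (hX 9%N)); lra.
  by apply: (le_trans LD'); rewrite ler_piMr.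
have Lh n : (n <= 9)%N -> c <= L * h ^+ n.
  move=> n9; apply: (le_trans LD'); rewrite ler_wpM2l //; first lra.
  by rewrite -(subnKC n9) exprD ler_piMr // ltW.
have L0 : 0 < L by lra.
(* [L ^ 8 <= Dmin] by the ninth Taylor term [L ^ 8 * (L * h ^ 9) / 9!], whence the exponent 9 in the
   hypothesis. *)
set Dmin := expR (h * L).
have Dmin8 : L ^+ 8 <= Dmin.
  have := @expR_ge1Dxn R (h * L) 8 (mulr_ge0 (ltW h0) (ltW L0)).
  rewrite -/Dmin; apply: le_trans.
  apply: (@le_trans _ _ ((h * L) ^+ 9 / 9`!%:R)); last by rewrite lerDr.
  rewrite ler_pdivlMr ?ltr0n ?fact_gt0 // (_ : (h * L) ^+ 9 = L ^+ 8 * (L * h ^+ 9)); last by ring.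
  by rewrite ler_wpM2l ?exprn_ge0 ?(ltW L0) // (le_trans c9).
clear c9.
have L8 n : (n <= 8)%N -> L ^+ n <= Dmin.
  by move=> n8; apply: le_trans Dmin8; rewrite ler_weXn2l //; lra.
(* Makes the total loss [10 * dl * k] over at most [L / h] rounds at most [h]. *)
set dl := h ^+ 2 / (10 * L).
have dl0 : 0 < dl by rewrite divr_gt0 // mulr_gt0.
have dlL : 10 * dl * L = h ^+ 2 by rewrite /dl; field; rewrite gt_eqF.
(* The tail exponent [dl ^ 2 / (8 * h * eps)] then has order [h ^ 3 * L ^ 2], beating the [2 * L] of
   the union bound, and [1 <= eps ^ 2 * Dmin] reads [L ^ 8 <= Dmin]. *)
set eps := L ^- 4.
have eps0 : 0 < eps by rewrite invr_gt0 exprn_gt0.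
have epsL : eps * L ^+ 4 = 1 by rewrite mulVf // gt_eqF // exprn_gt0.
have eps1 : eps <= 1 by rewrite invf_le1 ?exprn_gt0 // exprn_ege1 //; lra.
set k := Num.truncn ((1 - h) * L / h).
have k0 : 0 <= (1 - h) * L / h by rewrite divr_ge0 ?mulr_ge0 ?ltW //; lra.
have /andP[k1 k2] := truncn_itv k0; rewrite -/k -natr1 in k1 k2.
set n : R := k%:R in k1 k2.
have n0 : 0 <= n by rewrite ler0n.
rewrite ler_pdivlMr // in k1; rewrite ltr_pdivrMr // in k2.
have dln : 10 * dl * n <= h.
  rewrite -(ler_pM2r L0) mulrAC dlL expr2 -mulrA ler_pM2l // mulrC.
  by apply: (le_trans k1); rewrite ler_piMl //; lra.
have g01 : 0 < h <= 2^-1 by rewrite h0 /=; lra.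
have gdl : expR (- h) + 2 * dl <= 1.
  have := expRN_le (ltW h0).
  have : 2 * dl <= h / 2.
    have -> : 2 * dl = h * (h / (5 * L)) by rewrite /dl; field; rewrite gt_eqF.
    rewrite ler_pM2l // ler_pdivrMr ?mulr_gt0 //; lra.
  nra.
have eps01 : 0 < eps <= 1 by rewrite eps0.
have epsD : 1 <= eps ^+ 2 * Dmin.
  apply: le_trans (ler_wpM2l (exprn_ge0 2 (ltW eps0)) Dmin8).
  have -> : eps ^+ 2 * L ^+ 8 = (eps * L ^+ 4) ^+ 2 by rewrite exprMn -exprM.
  by rewrite epsL expr1n.
have dlD : 1 <= dl * Dmin.
  apply: le_trans (ler_wpM2l (ltW dl0) (L8 2%N isT)).
  have -> : dl * L ^+ 2 = (L * h ^+ 2) / 10 by rewrite /dl; field; rewrite gt_eqF.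
  have := Lh 2%N isT; lra.
have Dmin2 : 2 <= Dmin by have := L8 1%N isT; rewrite expr1; lra.
have rare : (1 + D%:R ^+ 2) * expR (- (dl ^+ 2 / (8 * h * eps))) <= dl.
  have -> : dl ^+ 2 / (8 * h * eps) = h ^+ 3 * L ^+ 2 / (8 * 100).
    by rewrite /dl /eps; field; rewrite (gt_eqF L0) (gt_eqF h0).
  have hL : 4 * L <= h ^+ 3 * L ^+ 2 / (8 * 100).
    have -> : h ^+ 3 * L ^+ 2 / (8 * 100) = L * (L * h ^+ 3) / (8 * 100) by ring.
    have := ler_wpM2l (ltW L0) (le_trans c0 (Lh 3%N isT)); lra.
  apply: (@le_trans _ _ ((2 * expR (2 * L)) * expR (- (4 * L)))).
    apply: ler_pM; rewrite ?expR_ge0 ?addr_ge0 ?exprn_ge0 ?(ltW DR) //; last first.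
      by rewrite ler_expR lerN2.
    rewrite DE -expRM_natl.
    have : 1 <= expR (2 * L) by rewrite -[leLHS]expR0 ler_expR; lra.
    lra.
  rewrite -mulrA -expRD (_ : 2 * L + - (4 * L) = - (2 * L)); last by ring.
  rewrite expRN ler_pdivrMr ?expR_gt0 //.
  have he := @expR_ge1Dxn R (2 * L) 1 (mulr_ge0 (ler0n R 2) (ltW L0)).
  rewrite (_ : 2`!%:R = 2 :> R) // in he.
  have : dl * (2 * L ^+ 2) <= dl * expR (2 * L).
    rewrite ler_pM2l //; apply: le_trans he.
    by rewrite (_ : (2 * L) ^+ 2 / 2 = 2 * L ^+ 2); [lra | field].
  apply: le_trans.
  have -> : dl * (2 * L ^+ 2) = 2 * (L * h ^+ 2) / 10 by rewrite /dl; field; rewrite gt_eqF.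
  have := Lh 2%N isT; lra.
have dlk : 10 * dl * n <= 1 by lra.
have Dk : Dmin * expR (h * n) <= D%:R.
  by rewrite DE /Dmin -expRD ler_expR mulrC [h * n]mulrC; lra.
have := nibble_iter e_sym e_irr g01 dl0 gdl eps01 epsD dlD Dmin2 rare dlk Dk (lexx _) sA.
apply: has_indep_le; rewrite ler_pM2r ?invr_gt0 // -/n.
(* The truncation loses at most [h] in [h * n], and [h <= h * L]. *)
have hn : (1 - 2 * h) * L <= h * n by nra.
have hn0 : 0 <= h * n by rewrite mulr_ge0 // ltW.
apply: (@le_trans _ _ (((1 - h) * (1 - h)) * (h * n))); last first.
  have -> : h * (1 - h) * n * (1 - 10 * dl * n) = ((1 - h) * (1 - 10 * dl * n)) * (h * n) by ring.
  by rewrite ler_wpM2r // ler_wpM2l //; lra.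
apply: (@le_trans _ _ ((1 - h) * (1 - h) * ((1 - 2 * h) * L))); last first.
  by rewrite ler_wpM2l // mulr_ge0 //; lra.
by rewrite mulrA ler_pM2r //; nra.
Qed.

(** * Volumes and lattice points *)

Section Volume.
Variable (R : realType).

Lemma vol_ge0 n (A : set (n.-tuple R)) : (0 <= vol A)%E.
Proof.
elim: n A => [|n IH] A /=; first by rewrite lee_fin indicE.
by apply: integral_ge0 => x _; exact: IH.
Qed.

(** The integral of a nonnegative function is a supremum over simple functions below it, so
    monotonicity holds for arbitrary sets. *)
Lemma le_vol n (A B : set (n.-tuple R)) : A `<=` B -> (vol A <= vol B)%E.
Proof.
elim: n A B => [|n IH] A B AB /=.
  by rewrite lee_fin !indicE ler_nat; case: (boolP (_ \in A)) => // /set_mem/AB/mem_set ->.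
rewrite !ge0_integralTE; [|by move=> x; exact: vol_ge0..].
apply: ge_ereal_sup => _ [g gA <-]; apply: ereal_sup_ubound.
by exists g => // x; apply: le_trans (gA x) _; apply: IH => t; exact: AB.
Qed.

Definition gfloor n (h : R) (x : n.-tuple R) : n.-tuple int :=
  [tuple of map (fun y => Num.floor (y / h)) x].

(** Union of half-open cubes of side [h] with corners [h * k], [k] in [s]. Balls are measured by
    comparison with such sets. *)
Definition cells n (h : R) (s : seq (n.-tuple int)) : set (n.-tuple R) :=
  [set x | gfloor h x \in s].

Lemma gfloor_cons n h x (t : n.-tuple R) :
  gfloor h (cons_tuple x t) = cons_tuple (Num.floor (x / h)) (gfloor h t).
Proof. exact: val_inj. Qed.

Lemma vol_cells n (h : R) (s : seq (n.-tuple int)) : 0 < h -> uniq s ->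
  vol (cells h s) = (h ^+ n * (size s)%:R)%:E.
Proof.
move=> h0; elim: n s => [|n IH] s us.
  rewrite /= indicE expr0 mul1r; congr (_%:E).
  have -> : ([tuple] \in cells h s) = ([tuple] \in s).
    apply/idP/idP => [/set_mem|h1].
      by rewrite /cells /= (tuple0 (gfloor _ _)).
    by apply/mem_set; rewrite /cells /= (tuple0 (gfloor _ _)).
  case: s us => [//|a [|b s]] /=; first by rewrite (tuple0 a) mem_head.
  by rewrite (tuple0 a) (tuple0 b) mem_head.
(* The section at [x] is again a union of cubes, indexed by the tails of the entries with head
   [floor (x / h)]; its volume is a sum of interval indicators. *)
pose sx (j : int) : seq (n.-tuple int) := [seq behead_tuple k | k <- s & thead k == j].
have sxE x : [set t | cells h s (cons_tuple x t)] = cells h (sx (Num.floor (x / h))).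
  apply/seteqP; split=> t; rewrite /cells /= gfloor_cons => ht.
    apply/mapP; exists (cons_tuple (Num.floor (x / h)) (gfloor h t)).
      by rewrite mem_filter ht theadE eqxx.
    exact: val_inj.
  have /mapP[k] := ht; rewrite mem_filter => /andP[/eqP kx ks] kt.
  suff -> : cons_tuple (Num.floor (x / h)) (gfloor h t) = k by [].
  by rewrite (tuple_eta k) -kx kt; exact: val_inj.
have usx j : uniq (sx j).
  rewrite map_inj_in_uniq ?filter_uniq // => k k'.
  rewrite !mem_filter => /andP[/eqP kj _] /andP[/eqP k'j _] kk'.
  rewrite (tuple_eta k) (tuple_eta k') kj k'j; apply: val_inj => /=.
  by move/(congr1 val): kk' => /= ->.
pose I (k : n.+1.-tuple int) : set R := `[(thead k)%:~R * h, ((thead k)%:~R + 1) * h[%classic.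
have sizeE x : vol [set t | cells h s (cons_tuple x t)] =
    (\sum_(k <- s) ((h ^+ n)%:E * (\1_(I k) x)%:E))%E.
  rewrite sxE IH // size_map size_filter -sum1_count natr_sum big_mkcond /= mulr_sumr.
  rewrite -sumEFin; apply: eq_bigr => k _; rewrite -EFinM; congr (_ * _)%:E.
  rewrite indicE.
  have -> : (x \in I k) = (thead k == Num.floor (x / h)); last by case: ifP.
  apply/idP/idP => [/set_mem|/eqP kx].
    rewrite /I /= in_itv /= -ler_pdivlMr // -ltr_pdivrMr // => hx.
    by rewrite eq_sym; apply/eqP/floor_def; rewrite -intrD1 in hx *.
  apply/mem_set; rewrite /I /= in_itv /= -ler_pdivlMr // -ltr_pdivrMr // kx.
  by rewrite floor_le /= -intrD1 floorD1_gt.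
rewrite /=; under eq_integral => x _ do rewrite sizeE.
have mI k : measurable (I k) by exact: measurable_itv.
have leb k : lebesgue_measure (I k) = h%:E.
  rewrite /I lebesgue_measure_itv /= lte_fin ltr_pM2r // ltrDl ltr01.
  by rewrite -EFinB; congr (_%:E); ring.
rewrite ge0_integral_sum //; last 2 first.
- move=> k; apply: measurable_funeM; apply/measurable_EFinP.
  by apply: measurable_indic; exact: mI.
- by move=> k x _; rewrite mule_ge0 // lee_fin ?exprn_ge0 ?indicE // ltW.
rewrite (eq_bigr (fun=> (h ^+ n.+1)%:E)); last first.
  move=> k _; rewrite ge0_integralZl_EFin //; last 2 first.
  - by apply/measurable_EFinP; apply: measurable_indic; exact: mI.
  - by rewrite exprn_ge0 // ltW.
  rewrite integral_indic; [|exact: measurableT|exact: mI].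
  by rewrite setIT (congr1 (fun z => ((h ^+ n)%:E * z)%E) (leb k)) -EFinM exprSr.
transitivity ((\sum_(k <- s) h ^+ n.+1)%:E); first by rewrite -sumEFin.
congr (_%:E).
by rewrite big_const_seq count_predT iter_addr addr0 mulr_natr.
Qed.
End Volume.

(** * Volumes of balls *)

Section Balls.
Variable (R : realType).

(** Minkowski's inequality without square roots, from [2 * u * v <= (b / a) * u ^ 2 + (a / b) * v ^
    2]. *)
Lemma sum_sqrD_le (I : finType) (x y : I -> R) (a b : R) : 0 < a -> 0 < b ->
  \sum_i x i ^+ 2 <= a ^+ 2 -> \sum_i y i ^+ 2 <= b ^+ 2 ->
  \sum_i (x i + y i) ^+ 2 <= (a + b) ^+ 2.
Proof.
move=> a0 b0 xa yb.
have ab : 0 < 1 + b / a by rewrite addr_gt0 // divr_gt0.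
have ba : 0 < 1 + a / b by rewrite addr_gt0 // divr_gt0.
apply: (@le_trans _ _ (\sum_i ((1 + b / a) * x i ^+ 2 + (1 + a / b) * y i ^+ 2))).
  apply: ler_sum => i _; rewrite -subr_ge0.
  have -> : (1 + b / a) * x i ^+ 2 + (1 + a / b) * y i ^+ 2 - (x i + y i) ^+ 2 =
    (b * x i - a * y i) ^+ 2 / (a * b) by field; rewrite (gt_eqF a0) (gt_eqF b0).
  by rewrite divr_ge0 ?sqr_ge0 // mulr_ge0 // ltW.
rewrite big_split /= -!mulr_sumr.
apply: (le_trans (lerD (ler_wpM2l (ltW ab) xa) (ler_wpM2l (ltW ba) yb))).
have -> : (1 + b / a) * a ^+ 2 + (1 + a / b) * b ^+ 2 = (a + b) ^+ 2.
  by field; rewrite (gt_eqF a0) (gt_eqF b0).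
by [].
Qed.

Lemma ball0E n rho (x : n.-tuple R) :
  @Defs.ball0 R n rho x = (\sum_(i < n) tnth x i ^+ 2 <= rho ^+ 2) :> Prop.
Proof.
rewrite /Defs.ball0 /= /sqdist; congr (is_true (_ <= _)); apply: eq_bigr => i _.
by rewrite tnth_nseq subr0.
Qed.

Lemma lattice_ball_enum n (rho : R) : exists s : seq (n.-tuple int),
  uniq s /\ forall k : n.-tuple int,
    (k \in s) = (\sum_(i < n) (tnth k i)%:~R ^+ 2 <= rho ^+ 2).
Proof.
have [b rb] : exists b : nat, `|rho| <= b%:R.
  by exists (Num.truncn `|rho|).+1; apply: ltW; exact: truncnS_gt.
pose f (t : n.-tuple 'I_(b + b).+1) : n.-tuple int :=
  [tuple of map (fun j : 'I_(b + b).+1 => (j : nat)%:Z - b%:Z) t].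
pose P (k : n.-tuple int) := \sum_(i < n) (tnth k i)%:~R ^+ 2 <= rho ^+ 2.
exists (undup [seq k <- map f (enum {: n.-tuple 'I_(b + b).+1}) | P k]).
split; first exact: undup_uniq.
move=> k; rewrite mem_undup mem_filter -/(P k).
have [Pk|//] := boolP (P k); rewrite /=.
have kb i : (`|tnth k i| <= b)%N.
  have h1 : ((tnth k i)%:~R : R) ^+ 2 <= `|rho| ^+ 2.
    rewrite real_normK ?num_real //; apply: le_trans Pk.
    by rewrite (bigD1 i) //= lerDl sumr_ge0 // => j _; exact: sqr_ge0.
  have : `|(tnth k i)%:~R : R| <= b%:R.
    apply: le_trans rb; rewrite -(@ler_pXn2r _ 2) ?nnegrE //.
    by rewrite real_normK ?num_real.
  by rewrite -intr_norm -[b%:R]/(b%:Z%:~R) ler_int -abszE lez_nat.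
apply/mapP; exists [tuple inord `|(tnth k i + b%:Z)%R|%N | i < n].
  by rewrite mem_enum.
apply: eq_from_tnth => i; rewrite tnth_map tnth_mktuple.
move: (tnth k i) (kb i) => z zb; rewrite inordK; lia.
Qed.

(** [c] bounds the diameter of the unit cube, so cubes with corners in a ball stay in the ball
    enlarged by [h * c]. *)
Lemma card_lattice_le_vol n (h c rho : R) (s : seq (n.-tuple int)) :
  0 < h -> 0 < c -> n%:R <= c ^+ 2 -> 0 < rho -> uniq s ->
  (forall k, k \in s -> \sum_(i < n) (tnth k i)%:~R ^+ 2 <= rho ^+ 2) ->
  ((h ^+ n * (size s)%:R)%:E <= vol (@Defs.ball0 R n (h * (rho + c))))%E.
Proof.
move=> h0 c0 nc r0 us sr; rewrite -(vol_cells h0 us); apply: le_vol => x /sr.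
rewrite ball0E => xr.
have -> : \sum_(i < n) tnth x i ^+ 2 = h ^+ 2 * \sum_(i < n) ((tnth (gfloor h x) i)%:~R +
    (tnth x i / h - (tnth (gfloor h x) i)%:~R)) ^+ 2.
  rewrite mulr_sumr; apply: eq_bigr => i _; rewrite -exprMn; congr (_ ^+ 2).
  by field; rewrite gt_eqF.
rewrite exprMn ler_wpM2l ?exprn_ge0 ?(ltW h0) //.
apply: sum_sqrD_le => //; apply: le_trans nc.
rewrite -[n in leRHS]card_ord -sum1_card natr_sum; apply: ler_sum => i _.
rewrite tnth_map; have := floor_le (tnth x i / h).
have := floorD1_gt (tnth x i / h); rewrite intrD; nra.
Qed.

Lemma vol_le_card_lattice n (h c rho : R) (s : seq (n.-tuple int)) :
  0 < h -> 0 < c -> n%:R <= c ^+ 2 -> 0 < rho -> uniq s ->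
  (forall k : n.-tuple int,
     \sum_(i < n) (tnth k i)%:~R ^+ 2 <= (rho + c) ^+ 2 -> k \in s) ->
  (vol (@Defs.ball0 R n (h * rho)) <= (h ^+ n * (size s)%:R)%:E)%E.
Proof.
move=> h0 c0 nc r0 us sr; rewrite -(vol_cells h0 us); apply: le_vol => x.
rewrite ball0E => xr; apply: sr.
have -> : \sum_(i < n) (tnth (gfloor h x) i)%:~R ^+ 2 =
   \sum_(i < n) (tnth x i / h + ((tnth (gfloor h x) i)%:~R - tnth x i / h)) ^+ 2 :> R.
  by apply: eq_bigr => i _; rewrite subrKC.
apply: sum_sqrD_le => //.
  under eq_bigr do rewrite exprMn; rewrite -mulr_suml exprVn ler_pdivrMr ?exprn_gt0 //.
  by rewrite -exprMn mulrC.
apply: le_trans nc.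
rewrite -[n in leRHS]card_ord -sum1_card natr_sum; apply: ler_sum => i _.
rewrite tnth_map; have := floor_le (tnth x i / h).
have := floorD1_gt (tnth x i / h); rewrite intrD; nra.
Qed.

Lemma exprn_near1 (x : R) n : 0 <= x <= 1 -> (1 + x) ^+ n <= 1 + 3 ^+ n * x.
Proof.
move=> /andP[x0 x1]; elim: n => [|n IH]; first by rewrite !expr0 mul1r lerDl.
rewrite exprS; apply: (le_trans (ler_wpM2l _ IH)); first lra.
have : 1 <= 3 ^+ n :> R by rewrite exprn_ege1 //; lra.
rewrite exprS; set u := 3 ^+ n => u1; rewrite -subr_ge0.
have -> : 1 + 3 * u * x - (1 + x) * (1 + u * x) = x * (u - 1) + u * (x * (1 - x)) by ring.
by rewrite addr_ge0 ?mulr_ge0 ?subr_ge0 // (le_trans ler01).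
Qed.

Lemma vol_ball0_fin n (rho : R) : vol (@Defs.ball0 R n rho) \is a fin_num.
Proof.
rewrite ge0_fin_numE ?vol_ge0 //.
pose r := `|rho| + 1; have r0 : 0 < r by rewrite ltr_wpDl.
have c0 : 0 < n%:R + 1 :> R by rewrite ltr_wpDl.
have [s [us sE]] := lattice_ball_enum n (r + (n%:R + 1)).
have nc : n%:R <= (n%:R + 1) ^+ 2 :> R.
  by have : 0 <= n%:R :> R by []; nra.
have := @vol_le_card_lattice n 1 _ r s ltr01 c0 nc r0 us.
move=> /(_ (fun k hk => etrans (sE k) hk)) hs.
apply: le_lt_trans (ltry (1 ^+ n * (size s)%:R)); apply: le_trans hs.
apply: le_vol => x; rewrite !ball0E => /le_trans; apply; rewrite mul1r.
rewrite -[rho ^+ 2]real_normK ?num_real //; apply: lerXn2r; rewrite ?nnegrE // ?lerDl //.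
exact: ltW.
Qed.

Definition ballvol n (rho : R) : R := fine (vol (@Defs.ball0 R n rho)).

Lemma ballvolE n rho : vol (@Defs.ball0 R n rho) = (ballvol n rho)%:E.
Proof. by rewrite fineK // vol_ball0_fin. Qed.

Lemma ballvol_ge0 n rho : 0 <= ballvol n rho.
Proof. by rewrite -lee_fin -ballvolE vol_ge0. Qed.

(** One set of lattice points serves twice: its cubes of side [t * h] cover the left ball, those of
    side [h] fit in the right one, and [b - a] pays for both boundary layers. This stands in for a
    change of variables. *)
Lemma ballvol_scale_lt n (t a b : R) : 0 < t -> 0 < a -> a < b ->
  ballvol n (t * a) <= t ^+ n * ballvol n b.
Proof.
move=> t0 a0 ab.
pose c : R := n%:R + 1; have c0 : 0 < c by rewrite ltr_wpDl.
have nc : n%:R <= c ^+ 2 by have : 0 <= n%:R :> R by []; rewrite /c; nra.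
pose h := (b - a) / (2 * c).
have h0 : 0 < h by rewrite divr_gt0 ?subr_gt0 // mulr_gt0.
have ah0 : 0 < a / h by rewrite divr_gt0.
have [s [us sE]] := lattice_ball_enum n (a / h + c).
have th0 : 0 < t * h by rewrite mulr_gt0.
have hs := @vol_le_card_lattice n _ _ _ s th0 c0 nc ah0 us (fun k hk => etrans (sE k) hk).
have ac0 : 0 < a / h + c by rewrite addr_gt0.
have hs' := @card_lattice_le_vol n _ _ _ s h0 c0 nc ac0 us
  (fun k hk => etrans (esym (sE k)) hk).
have hb : h * (a / h + c + c) = b.
  by rewrite /h; field; rewrite subr_eq0 (gt_eqF c0) (gt_eqF ab).
have ha : t * h * (a / h) = t * a by field; rewrite gt_eqF.
rewrite hb ballvolE lee_fin in hs'; rewrite ha ballvolE lee_fin in hs.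
by apply: (le_trans hs); rewrite exprMn -mulrA ler_wpM2l // exprn_ge0 // ltW.
Qed.

(** Limit of the strict version: [t * a = (t * (1 + s)) * (a / (1 + s))], and [(1 + s) ^ n] tends to
    1 with [s]. *)
Lemma ballvol_scale_le n (t a : R) : 0 < t -> 0 < a ->
  ballvol n (t * a) <= t ^+ n * ballvol n a.
Proof.
move=> t0 a0; set w := t ^+ n * _; set y := ballvol n (t * a).
have w0 : 0 <= w by rewrite mulr_ge0 ?ballvol_ge0 // exprn_ge0 // ltW.
have hs s : 0 < s -> y <= (1 + s) ^+ n * w.
  move=> s0; have s1 : 0 < 1 + s by rewrite addr_gt0.
  have ta : t * a = (t * (1 + s)) * (a / (1 + s)) by field; rewrite gt_eqF.
  rewrite /y ta /w [leRHS]mulrA -exprMn [(1 + s) * t]mulrC; apply: ballvol_scale_lt.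
  - exact: mulr_gt0.
  - exact: divr_gt0.
  - by rewrite ltr_pdivrMr // ltr_pMr //; lra.
apply/ler_addgt0Pr => d d0.
have C0 : 0 < 3 ^+ n * (w + 1) by rewrite mulr_gt0 ?exprn_gt0 // ltr_wpDl.
pose s := Num.min 1 (d / (3 ^+ n * (w + 1))).
have s0 : 0 < s by rewrite lt_min ltr01 divr_gt0.
have s1 : s <= 1 by rewrite ge_min lexx.
have s2 : s * (3 ^+ n * (w + 1)) <= d by rewrite -ler_pdivlMr // ge_min lexx orbT.
apply: (le_trans (hs _ s0)).
have := @exprn_near1 s n; rewrite s1 (ltW s0) => /(_ isT) hn.
apply: (le_trans (ler_wpM2r w0 hn)).
have : 0 <= 3 ^+ n * s by rewrite mulr_ge0 ?exprn_ge0 // ltW.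
lra.
Qed.

Lemma ballvol_scale n (rho : R) : 0 < rho -> ballvol n rho = rho ^+ n * ballvol n 1.
Proof.
move=> r0; apply/eqP; rewrite eq_le; apply/andP; split.
  by have := ballvol_scale_le n r0 ltr01; rewrite mulr1.
have ri : 0 < rho^-1 by rewrite invr_gt0.
have := ballvol_scale_le n ri r0; rewrite mulVf ?gt_eqF // exprVn mulrC.
by rewrite ler_pdivlMr ?exprn_gt0 // mulrC.
Qed.

(** One unit cube fits in the ball of radius [1 + c]; scaling does the rest. *)
Lemma ballvol1_gt0 n : 0 < ballvol n 1.
Proof.
pose c : R := n%:R + 1; have c0 : 0 < c by rewrite ltr_wpDl.
have nc : n%:R <= c ^+ 2 by have : 0 <= n%:R :> R by []; rewrite /c; nra.
have sr (k : n.-tuple int) : k \in [:: [tuple of nseq n 0]] ->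
    \sum_(i < n) ((tnth k i)%:~R : R) ^+ 2 <= 1 ^+ 2.
  rewrite inE => /eqP ->; rewrite big1 ?expr1n // => i _.
  by rewrite tnth_nseq expr0n.
have := @card_lattice_le_vol n 1 c 1 _ ltr01 c0 nc ltr01 (isT : uniq [:: _]) sr.
rewrite mul1r ballvolE lee_fin expr1n mul1r (ballvol_scale n (addr_gt0 ltr01 c0)) /= => h.
have : 0 < (1 + c) ^+ n * ballvol n 1 by exact: lt_le_trans h.
by rewrite pmulr_rgt0 // exprn_gt0 //; exact: addr_gt0.
Qed.

(** [r_] is an [xget] with default 0, so a radius of volume 1 must be exhibited: the [d]-th root of
    [1 / ballvol d 1]. *)
Lemma r_P d : (0 < d)%N -> 0 < r_ R d /\ r_ R d ^+ d * ballvol d 1 = 1.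
Proof.
move=> d0; have v0 := ballvol1_gt0 d.
have [] : [set r : R | 0 < r /\ vol (@Defs.ball0 R d r) = 1%E] (r_ R d).
  apply: xgetPex; exists ((ballvol d 1)^-1 `^ (d%:R^-1)).
  have r0 : 0 < (ballvol d 1)^-1 `^ (d%:R^-1) by rewrite powR_gt0 // invr_gt0.
  split=> //; rewrite ballvolE ballvol_scale // -powR_mulrn ?(ltW r0) //.
  rewrite -powRrM mulVf ?pnatr_eq0 -?lt0n // powRr1 ?invr_ge0 ?(ltW v0) //.
  by rewrite mulVf // gt_eqF.
move=> r0; rewrite ballvolE ballvol_scale // => -[h].
by split.
Qed.
End Balls.

(** * Tiling a box *)

Section Tiling.
Variables (R : realType) (d m m' : nat) (h : R).

(** Copy of the box point [k] in the translate [z], scaled by [h]. The period [m'] will exceed the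
    side [m], leaving an empty corridor between translates. *)
Definition tilept (k : d.-tuple 'I_m) (z : d.-tuple int) : d.-tuple R :=
  [tuple h * ((tnth k i : nat)%:R + m'%:R * (tnth z i)%:~R) | i < d].

Definition tiling (I : pred (d.-tuple 'I_m)) : set (d.-tuple R) :=
  [set t | exists k z, I k /\ t = tilept k z].

Lemma sqdist_tilept k z k' z' : sqdist (tilept k z) (tilept k' z') =
  h ^+ 2 * \sum_(i < d) (((tnth k i : nat)%:R - (tnth k' i : nat)%:R) +
     m'%:R * ((tnth z i)%:~R - (tnth z' i)%:~R)) ^+ 2.
Proof.
rewrite /sqdist mulr_sumr; apply: eq_bigr => i _; rewrite !tnth_mktuple; ring.
Qed.

Lemma tilept_inj k z k' z' : 0 < h -> (m <= m')%N ->
  tilept k z = tilept k' z' -> k = k' /\ z = z'.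
Proof.
move=> h0 mm' kz.
have eqi i : (tnth k i : nat) = (tnth k' i : nat) /\ tnth z i = tnth z' i.
  have := congr1 (fun t => tnth t i) kz; rewrite !tnth_mktuple.
  move/(mulfI (lt0r_neq0 h0)) => /eqP.
  have cast (a : nat) (b : int) :
      a%:R + m'%:R * b%:~R = ((a%:Z + m'%:Z * b)%:~R : R).
    by rewrite intrD intrM.
  rewrite !cast eqr_int => /eqP.
  have := ltn_ord (tnth k i); have := ltn_ord (tnth k' i).
  move: (tnth z i) (tnth z' i) (nat_of_ord (tnth k i)) (nat_of_ord (tnth k' i)).
  move=> x y a b am bm E.
  have xy : x = y by nia.
  by split=> //; move: E; rewrite xy; lia.
by split; apply: eq_from_tnth => i; have [h1 h2] := eqi i; rewrite ?h2 //; apply: val_inj.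
Qed.

(** Inside one translate the separation is that of [I]; between two translates some coordinate
    differs by at least the corridor [m' - m], up to the scale [h]. *)
Lemma tiling_packing (I : pred (d.-tuple 'I_m)) (r : R) : 0 < h -> 0 < r ->
  h * r = r_ R d -> 2 * r + m%:R <= m'%:R ->
  (forall u v, I u -> I v -> u != v ->
    (2 * r) ^+ 2 <= \sum_(i < d) ((tnth u i : nat)%:R - (tnth v i : nat)%:R) ^+ 2) ->
  sphere_packing (tiling I).
Proof.
move=> h0 r0 hr mm' Isep x y [k [z [Ik ->]]] [k' [z' [Ik' ->]]] xy.
rewrite sqdist_tilept -hr (_ : (2 * (h * r)) ^+ 2 = h ^+ 2 * (2 * r) ^+ 2); last by ring.
rewrite ler_wpM2l ?exprn_ge0 ?(ltW h0) //.
have [zz'|nz] := eqVneq z z'.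
  have kk' : k != k' by apply/eqP => kk'; apply: xy; rewrite kk' zz'.
  apply: (le_trans (Isep _ _ Ik Ik' kk')); apply: ler_sum => i _.
  by rewrite zz' subrr mulr0 addr0.
have [i zi] : exists i, tnth z i != tnth z' i.
  apply/existsP; apply: contraNT nz; rewrite negb_exists => /forallP h1.
  by apply/eqP/eq_from_tnth => i; apply/eqP; have := h1 i; rewrite negbK.
rewrite (bigD1 i) //=; set S := \sum_(_ < _ | _) _.
have S0 : 0 <= S by apply: sumr_ge0 => j _; exact: sqr_ge0.
apply: ler_wpDr => //.
rewrite -[leRHS]real_normK ?num_real //; apply: lerXn2r; rewrite ?nnegrE //; first lra.
have kk : `|(tnth k i : nat)%:R - (tnth k' i : nat)%:R : R| <= m%:R.
  rewrite ler_distlC.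
  have : (tnth k i : nat)%:R <= m%:R :> R by rewrite ler_nat ltnW.
  have : (tnth k' i : nat)%:R <= m%:R :> R by rewrite ler_nat ltnW.
  have : 0 <= (tnth k i : nat)%:R :> R by [].
  have : 0 <= (tnth k' i : nat)%:R :> R by [].
  lra.
have zz : m'%:R <= `|m'%:R * ((tnth z i)%:~R - (tnth z' i)%:~R) : R|.
  rewrite normrM normr_nat ler_peMr // -intrB -intr_norm -[1]/(1%:~R) ler_int.
  by move/eqP: zi; lia.
have := lerB_normD (m'%:R * ((tnth z i)%:~R - (tnth z' i)%:~R) : R)
  ((tnth k i : nat)%:R - (tnth k' i : nat)%:R).
rewrite [_ * _ + _]addrC; lra.
Qed.

(** Whole translates inside a large ball are counted, each carrying [#|I|] points. The boundary
    layer is a vanishing fraction, absorbed by the strict inequality on [B]. *)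
Lemma tiling_density (I : pred (d.-tuple 'I_m)) (B : R) : (0 < d)%N -> 0 < h ->
  (0 < m)%N -> (m <= m')%N -> B < #|I|%:R / (h * m'%:R) ^+ d ->
  (B%:E <= packing_density (tiling I))%E.
Proof.
move=> d0 h0 m0 mm' BI.
pose c : R := d%:R + 1; have c0 : 0 < c by rewrite ltr_wpDl.
have dc : d%:R <= c ^+ 2 by have : 0 <= d%:R :> R by []; rewrite /c; nra.
have m'0 : 0 < m'%:R :> R by rewrite ltr0n (leq_trans m0).
have hm : 0 < h * m'%:R by rewrite mulr_gt0.
pose a := (h * m'%:R)^-1; have a0 : 0 < a by rewrite invr_gt0.
pose Q := #|I|%:R * a ^+ d.
have BQ : 0 < Q - B by rewrite subr_gt0 /Q /a exprVn.
have Q0 : 0 <= Q by rewrite mulr_ge0 // exprn_ge0 // ltW.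
rewrite /packing_density /limsup_pinfty; apply: le_ereal_inf_tmp => _ [M _ <-].
(* For the limsup one radius beyond each [M] suffices. The term [4 * c / a] makes [sg - c] positive;
   the last one keeps the boundary loss below [Q - B]. *)
pose rho := `|M| + 1 + 4 * c / a + 2 * c * d%:R * Q / (a * (Q - B)).
have t1 : 0 < 4 * c / a by rewrite divr_gt0 // mulr_gt0.
have t2 : 0 <= 2 * c * d%:R * Q / (a * (Q - B)).
  have cd0 : 0 <= 2 * c * d%:R by do 2 apply: mulr_ge0 => //; exact: ltW.
  exact: divr_ge0 (mulr_ge0 cd0 Q0) (mulr_ge0 (ltW a0) (ltW BQ)).
have M0 : 0 <= `|M| by [].
have rho0 : 0 < rho by rewrite /rho; lra.
have Mrho : M <= rho by have := ler_norm M; rewrite /rho; lra.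
apply: (le_trans _ (ereal_sup_ubound _)); last by exists rho.
have ra : 4 * c <= rho * a by rewrite -ler_pdivrMr // /rho; lra.
have rQ : 2 * c * d%:R * Q <= rho * (a * (Q - B)).
  by rewrite -ler_pdivrMr ?mulr_gt0 // /rho; lra.
(* In units of [h * m'], offsets inside the box have norm at most [c], so translates with [z] of
   norm at most [sg] lie in the ball. *)
pose sg := rho * a - c.
have sg0 : 0 < sg by rewrite /sg; lra.
have [s [us sE]] := lattice_ball_enum d sg.
pose L := [seq tilept k z | k <- enum I, z <- s].
have uL : uniq L.
  apply: allpairs_uniq => //; first exact: enum_uniq.
  by move=> [k z] [k' z'] _ _ /= /(tilept_inj h0 mm')[-> ->].
have LP : [set` L] `<=` tiling I `&` @Defs.ball0 R d rho.
  move=> t /= /allpairsP[[k z] /= [kI zs ->]]; split.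
    by exists k, z; split => //; move: kI; rewrite mem_enum.
  rewrite ball0E.
  have -> : \sum_(i < d) tnth (tilept k z) i ^+ 2 = h ^+ 2 *
     \sum_(i < d) ((tnth k i : nat)%:R + m'%:R * (tnth z i)%:~R) ^+ 2.
    by rewrite mulr_sumr; apply: eq_bigr => i _; rewrite tnth_mktuple exprMn.
  have -> : rho = h * (m'%:R * c + m'%:R * sg).
    by rewrite /sg /a; field; rewrite (gt_eqF h0) (gt_eqF m'0).
  rewrite exprMn ler_wpM2l ?exprn_ge0 ?(ltW h0) //.
  apply: sum_sqrD_le; rewrite ?mulr_gt0 //.
    rewrite exprMn mulrC.
    apply: le_trans (ler_wpM2r (exprn_ge0 2 (ltW m'0)) dc).
    rewrite -[d in leRHS]card_ord -sum1_card natr_sum mulr_suml; apply: ler_sum => i _.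
    rewrite mul1r; apply: lerXn2r; rewrite ?nnegrE // ler_nat.
    by apply: leq_trans mm'; exact: ltnW.
  under eq_bigr do rewrite exprMn; rewrite -mulr_sumr exprMn ler_wpM2l ?exprn_ge0 //.
  by rewrite -sE.
have sc0 : 0 < sg - c by rewrite /sg; lra.
have sizes : (sg - c) ^+ d * ballvol d (1 : R) <= (size s)%:R.
  have hs := @vol_le_card_lattice R d 1 c (sg - c) s ltr01 c0 dc sc0 us.
  rewrite subrK in hs; have {hs} := hs (fun k hk => etrans (sE k) hk).
  by rewrite mul1r ballvolE ballvol_scale // lee_fin expr1n mul1r.
have v0 := ballvol1_gt0 R d.
have cnt : ((#|I|%:R * (size s)%:R)%:E <= count_in (tiling I) rho)%E.
  rewrite /count_in; apply: esum_ge; exists [set` L]; first by split; [exact: finite_seq|exact: LP].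
  have -> : #|I|%:R * (size s)%:R = (size L)%:R :> R by rewrite size_allpairs -cardE natrM.
  by rewrite -fsbig_seq // -sum1_size natr_sum -sumEFin.
apply: (@le_trans _ _ ((#|I|%:R * (size s)%:R)%:E *
  ((fine (vol (@Defs.ball0 R d rho)))^-1)%:E)%E); last first.
  by apply: lee_wpmul2r => //; rewrite lee_fin invr_ge0 fine_ge0 // vol_ge0.
rewrite -EFinM lee_fin -/(ballvol d rho) ballvol_scale //.
apply: (@le_trans _ _ (#|I|%:R * ((sg - c) ^+ d * ballvol d (1 : R)) /
                         (rho ^+ d * ballvol d (1 : R)))); last first.
  rewrite ler_wpM2r ?invr_ge0 ?mulr_ge0 ?exprn_ge0 ?(ltW rho0) ?(ltW v0) //.
  by rewrite ler_wpM2l.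
have -> : #|I|%:R * ((sg - c) ^+ d * ballvol d (1 : R)) / (rho ^+ d * ballvol d (1 : R)) =
   Q * (1 - 2 * c / (rho * a)) ^+ d.
  have -> : 1 - 2 * c / (rho * a) = (sg - c) / (rho * a).
    by rewrite /sg; field; rewrite (gt_eqF a0) (gt_eqF rho0).
  rewrite /Q expr_div_n exprMn; field.
  by rewrite !expf_eq0 (gt_eqF a0) (gt_eqF rho0) (gt_eqF v0) !andbF.
have p01 : 0 <= 2 * c / (rho * a) <= 1.
  have ra0 : 0 < rho * a by rewrite mulr_gt0.
  by rewrite divr_ge0 ?ler_pdivrMr ?mulr_ge0 ?(ltW c0) ?(ltW ra0) //=; lra.
apply: le_trans (ler_wpM2l Q0 (bernoulli_ineq d p01)).
have -> : Q * (1 - d%:R * (2 * c / (rho * a))) = Q - (2 * c * d%:R * Q) / (rho * a).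
  by field; rewrite (gt_eqF a0) (gt_eqF rho0).
have : (2 * c * d%:R * Q) / (rho * a) <= Q - B.
  rewrite ler_pdivrMr ?mulr_gt0 //.
  by have -> : (Q - B) * (rho * a) = rho * (a * (Q - B)) by ring.
lra.
Qed.
End Tiling.

(** * Sparse random subsets of a box *)

Section Sampling.
Variables (R : realType) (T : finType) (e near : rel T).

(** Deletion method: a random set of density [p] loses its points that have a near point, high
    degree, or high codegree with another chosen point. The failure bounds are [b0], [b1] and
    [b4 * b2], the last being the expected number of chosen points sharing a neighbour times the
    codegree tail. *)
Lemma sparse_sample (p mu1 t1 a1 b1 mu2 t2 a2 b2 b0 b4 : R) (D : nat) (K : R) :
  irreflexive e -> irreflexive near -> 0 < p <= 1 ->
  (forall v, p * #|near v|%:R <= b0) ->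
  (forall v, p * #|e v|%:R <= mu1) ->
  (forall u v, u != v -> ~~ near v u -> p * #|[pred x | e u x && e v x]|%:R <= mu2) ->
  (forall v, p * #|[pred u | [exists x, e u x && e v x]]|%:R <= b4) ->
  0 <= a1 <= 2^-1 -> expR (- (a1 * t1) + 2 * a1 ^+ 2 * mu1) <= b1 ->
  0 <= a2 <= 2^-1 -> expR (- (a2 * t2) + 2 * a2 ^+ 2 * mu2) <= b2 ->
  mu1 + t1 <= D%:R -> 0 < mu2 + t2 -> mu2 + t2 <= K ->
  exists2 A : pred T, sparse e A D K &
    p * #|T|%:R * (1 - b0 - b1 - b4 * b2) <= #|A|%:R.
Proof.
move=> e_irr n_irr pp hnear hdeg hcod hfar ha1 hb1 ha2 hb2 hD m20 hK.
have [p0 p1] := andP pp; have p01 : 0 <= p <= 1 by rewrite ltW.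
pose s := enum {: T}.
have us : uniq s by exact: enum_uniq.
have ms v : v \in s by rewrite mem_enum.
have countE (P : pred T) : count P s = #|P| by rewrite /s enumT -size_filter cardE.
pose hideg v (X : seq T) := mu1 + t1 <= (count (e v) X)%:R.
pose hicod u v (X : seq T) := mu2 + t2 <= (count [pred x | e u x && e v x] X)%:R.
pose Q v := [pred u | [&& u != v, ~~ near v u & [exists x, e u x && e v x]]].
pose A (X : seq T) : pred T := [pred v | [&& v \in X, ~~ has (near v) X, ~~ hideg v X &
  all (fun u => (u == v) || ~~ hicod u v X) X]].
(* Union bound for keeping [v], insensitive to whether [v] is in [X], so that membership factors out
   as [p]. *)
pose G v (X : seq T) : R := 1 - \sum_(u | near v u) (u \in X)%:R - (hideg v X)%:R
   - \sum_(u | Q v u) (u \in X)%:R * (hicod u v X)%:R.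
have b10 : 0 <= b1 by apply: le_trans hb1; exact: expR_ge0.
have b20 : 0 <= b2 by apply: le_trans hb2; exact: expR_ge0.
have AG v X : (v \in X)%:R * G v X <= (A X v)%:R.
  rewrite /A /= /G; case: (v \in X) => /=; last by rewrite mul0r.
  rewrite mul1r.
  have S1 : 0 <= \sum_(u | near v u) (u \in X)%:R :> R by apply: sumr_ge0.
  have S2 : 0 <= \sum_(u | Q v u) (u \in X)%:R * (hicod u v X)%:R :> R.
    by apply: sumr_ge0 => u _; rewrite mulr_ge0.
  have [/hasP[u uX nu]|nnear] := boolP (has (near v) X) => /=.
    have : 1 <= \sum_(u | near v u) (u \in X)%:R :> R.
      by rewrite (bigD1 u) //= uX lerDl sumr_ge0.
    by case: (hideg v X) => /=; lra.
  case: (hideg v X) => /=; first lra.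
  have [|nall] := boolP (all _ X) => /=; first lra.
  have /allPn[u uX] := nall; rewrite negb_or negbK => /andP[uv hu].
  have Qu : Q v u.
    rewrite /Q /= uv (hasPn nnear) //=; apply: contraT; rewrite negb_exists => /forallP nex.
    move: hu; rewrite /hicod (_ : count _ _ = 0%N); first by rewrite leNgt m20.
    by apply/eqP; rewrite -leqn0 leqNgt -has_count -all_predC; apply/allP => x _ /=; exact: nex.
  have : 1 <= \sum_(u | Q v u) (u \in X)%:R * (hicod u v X)%:R :> R.
    by rewrite (bigD1 u) //= uX hu mulr1 lerDl sumr_ge0 // => w _; rewrite mulr_ge0.
  lra.
have EG v : p * (1 - b0 - b1 - b4 * b2) <= bexp p s (fun X => (v \in X)%:R * G v X).
  rewrite bexp_mem //; last first.
    move=> X Y; rewrite /G; congr (1 - _ - _ - _).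
    - apply: eq_bigr => u nu; rewrite !mem_cat inE (_ : u == v = false) //.
      by apply/negP => /eqP uv; move: nu; rewrite uv n_irr.
    - by rewrite /hideg !count_cat /= e_irr.
    - apply: eq_bigr => u /and3P[uv _ _]; rewrite !mem_cat inE (negPf uv) /=.
      by rewrite /hicod !count_cat /= e_irr andbF.
  rewrite ler_pM2l // /G !bexpB bexp_cst !bexp_sum.
  apply: lerB; first (apply: lerB; first apply: lerB) => //.
  - apply: le_trans (hnear v).
    rewrite -sum1_card natr_sum mulr_sumr; apply: ler_sum => u _.
    have := @bexp_mem R T p s u (fun=> 1) us (ms u) (fun _ _ => erefl).
    rewrite bexp_cst => <-; apply: ler_bexp => // X _; by rewrite mulr1.
  - apply: le_trans hb1; apply: bexp_upper_tail_count => //.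
    by rewrite countE.
  - apply: (@le_trans _ _ (\sum_(u | Q v u) p * b2)).
      apply: ler_sum => u /and3P[uv nvu _]; rewrite bexp_mem //; last first.
        by move=> X Y; rewrite /hicod !count_cat /= e_irr.
      rewrite ler_pM2l //; apply: le_trans hb2; apply: bexp_upper_tail_count => //.
      by rewrite countE hcod.
    rewrite sumr_const -(mulr_natl (p * b2)) mulrA ler_wpM2r // mulrC.
    apply: le_trans (hfar v); rewrite ler_pM2l // ler_nat.
    by apply: subset_leq_card; apply/fintype.subsetP => u; rewrite !inE => /and3P[].
have [X _ XE] := bexp_witness p01 s (fun X => #|A X|%:R).
exists (A X).
  split=> [v|u v].
    move=> /and4P[_ _ hv _]; rewrite -(ler_nat R); apply: le_trans hD.
    apply: (@le_trans _ _ (count (e v) X)%:R); last by apply: ltW; rewrite ltNge.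
    rewrite ler_nat -size_filter; apply: leq_trans (card_size _).
    apply: subset_leq_card; apply/fintype.subsetP => w; rewrite !inE mem_filter.
    by move=> /andP[/and4P[-> _ _ _] ->].
  move=> /and4P[uX _ _ _] /and4P[_ _ _ /allP/(_ _ uX)] + uv.
  rewrite (negPf uv) /= -ltNge => hc; apply: le_trans hK; apply: le_trans (ltW hc).
  rewrite ler_nat -size_filter; apply: leq_trans (card_size _).
  apply: subset_leq_card; apply/fintype.subsetP => w; rewrite !inE mem_filter /=.
  by move=> /andP[/andP[/and4P[-> _ _ _] ->] /andP[_ ->]].
apply: le_trans XE.
have -> : bexp p s (fun X => #|A X|%:R) = \sum_v bexp p s (fun X => (A X v)%:R).
  by rewrite -bexp_sum; apply: eq_bexp => // Y _; rewrite natr_card.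
rewrite (_ : p * #|T|%:R * _ = \sum_(v : T) p * (1 - b0 - b1 - b4 * b2)); last first.
  by rewrite sumr_const -(mulr_natl (p * _)); ring.
apply: ler_sum => v _; apply: (le_trans (EG v)); apply: ler_bexp => // Y _; exact: AG.
Qed.
End Sampling.

(** * Distances and counting in the box *)

Section Box.
Variables (R : realType) (d m : nat).
Implicit Types u v w : d.-tuple 'I_m.

Definition boxd u v : R :=
  \sum_(i < d) ((tnth u i : nat)%:R - (tnth v i : nat)%:R) ^+ 2.

Definition close (rho : R) : rel (d.-tuple 'I_m) :=
  fun u v => (u != v) && (boxd u v < rho ^+ 2).

Lemma boxdC u v : boxd u v = boxd v u.
Proof. by apply: eq_bigr => i _; rewrite -sqrrN opprB. Qed.

Lemma close_sym rho : symmetric (close rho).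
Proof. by move=> u v; rewrite /close eq_sym boxdC. Qed.

Lemma close_irr rho : irreflexive (close rho).
Proof. by move=> u; rewrite /close eqxx. Qed.

Variable c : R.
Hypotheses (c0 : 0 < c) (dc : d%:R <= c ^+ 2).

(** Translation by [- z] sends the points injectively to integer points of a centred ball, which is
    why the centre is integral. *)
Lemma card_box_ball (z : d.-tuple int) (P : pred (d.-tuple 'I_m)) (rho : R) :
  0 < rho ->
  (forall w, P w -> \sum_(i < d) ((tnth w i : nat)%:R - (tnth z i)%:~R) ^+ 2 <= rho ^+ 2) ->
  #|P|%:R <= ballvol d 1 * (rho + c) ^+ d.
Proof.
move=> rho0 Pz.
pose f w : d.-tuple int := [tuple (tnth w i : nat)%:Z - tnth z i | i < d].
have f_inj : injective f.
  move=> u v uv; apply: eq_from_tnth => i; apply: val_inj => /=.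
  have := congr1 (fun t => tnth t i) uv; rewrite !tnth_mktuple => /addIr.
  by move=> [].
have us : uniq (map f (enum P)) by rewrite map_inj_uniq ?enum_uniq.
have := @card_lattice_le_vol R d 1 c rho _ ltr01 c0 dc rho0 us.
have rc0 : 0 < rho + c by rewrite addr_gt0.
rewrite size_map -cardE mul1r ballvolE ballvol_scale // lee_fin expr1n mul1r mulrC.
apply=> k /mapP[w]; rewrite mem_enum => Pw ->; apply: le_trans (Pz w Pw).
by apply: ler_sum => i _; rewrite tnth_mktuple intrB.
Qed.

Lemma card_close v (rho : R) : 0 < rho ->
  #|close rho v|%:R <= ballvol d 1 * (rho + c) ^+ d.
Proof.
move=> rho0; apply: (@card_box_ball [tuple (tnth v i : nat)%:Z | i < d]) => //.
move=> w /andP[_ /ltW]; rewrite boxdC; apply: le_trans.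
by apply: ler_sum => i _; rewrite tnth_mktuple.
Qed.

Lemma card_common_exists v (rho : R) : 0 < rho ->
  #|[pred u | [exists x, close rho u x && close rho v x]]|%:R <=
  ballvol d 1 * (rho + rho + c) ^+ d.
Proof.
move=> rho0; apply: (@card_box_ball [tuple (tnth v i : nat)%:Z | i < d]).
  by rewrite addr_gt0.
move=> u /existsP[x /andP[/andP[_ /ltW ux] /andP[_ /ltW vx]]].
have := sum_sqrD_le rho0 rho0 ux; rewrite boxdC in vx => /(_ _ vx).
apply: le_trans; apply: ler_sum => i _; rewrite tnth_mktuple.
by rewrite addrA subrK.
Qed.

(* The intersection of two balls of radius [rho] whose centres are [s] apart lies
   in the ball of radius [sqrt (rho^2 - s^2 / 4)] about the midpoint. *)
Lemma card_common u v (rho s rho' : R) : 0 < rho' -> s ^+ 2 <= boxd u v ->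
  rho ^+ 2 - s ^+ 2 / 4 <= rho' ^+ 2 ->
  #|[pred x | close rho u x && close rho v x]|%:R <= ballvol d 1 * (rho' + c + c) ^+ d.
Proof.
move=> r0 suv hr.
(* The midpoint may have half-integer coordinates; rounding it down costs the second [c]. *)
pose z : d.-tuple int := [tuple ((tnth u i + tnth v i)./2)%:Z | i < d].
apply: (@card_box_ball z); first by rewrite addr_gt0.
move=> w /andP[/andP[_ /ltW uw] /andP[_ /ltW vw]].
pose mid i : R := ((tnth u i : nat)%:R + (tnth v i : nat)%:R) / 2.
have -> : \sum_(i < d) ((tnth w i : nat)%:R - (tnth z i)%:~R) ^+ 2 =
  \sum_(i < d) (((tnth w i : nat)%:R - mid i) + (mid i - (tnth z i)%:~R)) ^+ 2 :> R.
  by apply: eq_bigr => i _; rewrite addrA subrK.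
apply: sum_sqrD_le => //.
  have -> : \sum_(i < d) ((tnth w i : nat)%:R - mid i) ^+ 2 =
      (boxd u w + boxd v w) / 2 - boxd u v / 4.
    rewrite /boxd -big_split /= !mulr_suml -sumrB; apply: eq_bigr => i _.
    by rewrite /mid; field.
  lra.
apply: le_trans dc.
rewrite -[d in leRHS]card_ord -sum1_card natr_sum; apply: ler_sum => i _.
rewrite /mid tnth_mktuple -natrD; set k := (_ + _)%N.
rewrite -[in k%:R](odd_double_half k) natrD -muln2 natrM.
rewrite (_ : (k./2%:Z)%:~R = k./2%:R :> R) //.
have -> : ((odd k)%:R + k./2%:R * 2) / 2 - k./2%:R = (odd k)%:R / 2 :> R by field.
by case: (odd k) => /=; lra.
Qed.
End Box.

(** [v * (2 * rad) ^ d] approximates the degree of the full grid, so sampling at rate [p] brings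
    degrees to about [X], with codegree means at most [mu]. The lower bounds on [rad] tame the
    errors of counting by volume; [C1], [C2] and [C3] keep each of the three deletion losses below
    [h]. *)
Lemma box_indep (R : realType) (d m : nat) (x h rad : R) :
  let v := ballvol d (1 : R) in let X := x ^+ d in
  let mu := X * expR (- (d%:R / (64 * x ^+ 2))) in
  (0 < d)%N -> 1 <= x -> 0 < h <= 16^-1 ->
  64 * x ^+ 2 * (d%:R + 1) <= rad -> 3 ^+ d * (d%:R + 1) <= h * rad ->
  X <= v * (2 * rad) ^+ d ->
  (3 / 4) ^+ d <= h -> expR (- (h ^+ 2 * X / 16)) <= h ->
  X * 3 ^+ d * expR (- (mu / 8)) <= h ->
  10 ^+ 6 / h ^+ 9 <= ln X ->
  32 * ln X ^+ 4 * expR (- (d%:R / (64 * x ^+ 2))) <= 1 -> 1 <= h * X ->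
  exists I : pred (d.-tuple 'I_m),
    (forall u v, I u -> I v -> u != v -> (2 * rad) ^+ 2 <= boxd R u v) /\
    (1 - 4 * h) * (1 - 3 * h) / (1 + 3 * h) * ln X * (m%:R ^+ d / (v * (2 * rad) ^+ d))
      <= #|I|%:R.
Proof.
move=> v X mu d0 x1 /andP[h0 h16].
have hb1 : h <= 1 by lra.
have hb3 : 0 <= 1 - 3 * h by lra.
have hb4 : 0 <= 1 - 4 * h by lra.
have h3 : 0 < 1 + 3 * h by lra.
have h4 : 0 < h <= 4^-1 by rewrite h0 /=; lra.
(* Chernoff parameters: [h / 8] for the deviation [h * X] of degrees, [1/4] for the deviation [mu]
   of codegrees. *)
have a1 : 0 <= h / 8 <= 2^-1 by apply/andP; lra.
have a2 : 0 <= (4^-1 : R) <= 2^-1 by apply/andP; lra.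
have h9 : 1 <= 10 ^+ 6 / h ^+ 9.
  rewrite ler_pdivlMr ?exprn_gt0 // mul1r (@le_trans _ _ 1) //.
    by apply: exprn_ile1 => //; exact: ltW.
  by apply: exprn_ege1; lra.
move=> rad1 rad2 Xv C1 C2 C3 C4; have lnX1 := le_trans h9 C4.
move: C4 {h9}; set N := 10 ^+ 6 / h ^+ 9 => C4 C5 C6.
set c : R := d%:R + 1 in rad1 rad2.
have c1 : 1 <= c by rewrite /c lerDr.
have c0 : 0 < c by lra.
have dc : d%:R <= c ^+ 2 by have : 0 <= d%:R :> R by []; rewrite /c; nra.
have x0 : 0 < x by lra.
have X0 : 0 < X by rewrite exprn_gt0.
have X1 : 1 <= X by rewrite exprn_ege1.
have x21 : 1 <= x ^+ 2 by rewrite exprn_ege1.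
have rad0 : 0 < rad by nra.
have v0 : 0 < v by exact: ballvol1_gt0.
have W0 : 0 < v * (2 * rad) ^+ d by rewrite mulr_gt0 // exprn_gt0 // mulr_gt0.
set W := v * (2 * rad) ^+ d in Xv W0 *.
set p := X / W.
have p0 : 0 < p by rewrite divr_gt0.
have p1 : p <= 1 by rewrite ler_pdivrMr // mul1r.
have r2 : 0 < 2 * rad by rewrite mulr_gt0.
have pW y : p * (v * y ^+ d) = X * (y / (2 * rad)) ^+ d.
  by rewrite /p /W expr_div_n; field; rewrite expf_eq0 (gt_eqF r2) (gt_eqF v0) andbF.
have pcount (n : nat) (y z : R) : n%:R <= v * y ^+ d -> 0 <= y -> y <= z * (2 * rad) ->
    p * n%:R <= X * z ^+ d.
  move=> ny y0 yz; apply: (le_trans (ler_wpM2l (ltW p0) ny)); rewrite pW.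
  rewrite ler_wpM2l ?(ltW X0) //; apply: lerXn2r.
  - by rewrite nnegrE divr_ge0 // ltW.
  - by rewrite nnegrE -(pmulr_lge0 _ r2) (le_trans y0).
  - by rewrite ler_pdivrMr.
pose e := @close R d m (2 * rad); pose near := @close R d m (rad / x).
have rx0 : 0 < rad / x by rewrite divr_gt0.
have cx : 2 * x * c <= rad.
  apply: le_trans rad1; rewrite ler_wpM2r ?(ltW c0) //; nra.
(* By volume alone the bound would be [X * (1 / (2 * x)) ^ d = 2 ^ - d]; the lattice error [c] turns
   [1/2] into [3/4]. *)
have hnear u : p * #|near u|%:R <= (3 / 4) ^+ d.
  have -> : (3 / 4) ^+ d = X * (3 / 4 / x) ^+ d.
    by rewrite /X -exprMn; congr (_ ^+ _); field; rewrite gt_eqF.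
  apply: pcount (card_close c0 dc u rx0) _ _; first by rewrite addr_ge0 // ltW.
  rewrite -(ler_pM2r x0) mulrDl divfK ?gt_eqF //.
  have -> : 3 / 4 / x * (2 * rad) * x = 3 / 2 * rad by field; rewrite gt_eqF.
  lra.
have hdeg u : p * #|e u|%:R <= X * (1 + h).
  have tau : 0 <= c / (2 * rad) <= 1.
    rewrite divr_ge0 ?(ltW c0) ?(ltW r2) // ler_pdivrMr //=; nra.
  apply: (@le_trans _ _ (X * (1 + c / (2 * rad)) ^+ d)).
    apply: pcount (card_close c0 dc u r2) _ _; first by rewrite addr_ge0 // ltW.
    have -> // : (1 + c / (2 * rad)) * (2 * rad) = 2 * rad + c.
    by field; rewrite gt_eqF.
  rewrite ler_pM2l //; apply: (le_trans (exprn_near1 d tau)).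
  rewrite lerD2l mulrA ler_pdivrMr //; nra.
have hcod u w : u != w -> ~~ near w u ->
    p * #|[pred y | e u y && e w y]|%:R <= mu.
  move=> uw nwu.
  have suw : (rad / x) ^+ 2 <= boxd R u w.
    by move: nwu; rewrite /near /close eq_sym uw /= -leNgt boxdC.
  (* Upper bound for the square root of [1 - 1 / (16 * x ^ 2)]. Half of the gain is given up to the
     lattice error [2 * c], leaving [1 / (64 * x ^ 2)]. *)
  pose q := 1 - (32 * x ^+ 2)^-1.
  have ix0 : 0 < (32 * x ^+ 2)^-1 by rewrite invr_gt0 mulr_gt0 // exprn_gt0.
  have ix1 : (32 * x ^+ 2)^-1 <= 2^-1 by rewrite lef_pV2 ?posrE ?mulr_gt0 ?exprn_gt0 //; lra.
  have q0 : 0 < 2 * rad * q by rewrite mulr_gt0 // /q; lra.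
  have hr : (2 * rad) ^+ 2 - (rad / x) ^+ 2 / 4 <= (2 * rad * q) ^+ 2.
    rewrite -subr_ge0 (_ : _ - _ = (2 * rad / (32 * x ^+ 2)) ^+ 2) ?sqr_ge0 //.
    by rewrite /q; field; rewrite gt_eqF.
  apply: (@le_trans _ _ (X * (1 - (64 * x ^+ 2)^-1) ^+ d)).
    apply: pcount (card_common c0 dc q0 suw hr) _ _.
      by rewrite !addr_ge0 // ltW.
    have -> : (1 - (64 * x ^+ 2)^-1) * (2 * rad) = 2 * rad * q + rad / (32 * x ^+ 2).
      by rewrite /q; field; rewrite gt_eqF.
    rewrite -addrA lerD2l ler_pdivlMr ?mulr_gt0 ?exprn_gt0 //; lra.
  rewrite /mu ler_pM2l //.
  have -> : - (d%:R / (64 * x ^+ 2)) = d%:R * - (64 * x ^+ 2)^-1 by rewrite mulrN.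
  rewrite expRM_natl; apply: lerXn2r; rewrite ?nnegrE ?expR_ge0 ?expR_ge1Dx //.
  by rewrite subr_ge0 invf_le1 ?mulr_gt0 ?exprn_gt0 //; lra.
have hfar u : p * #|[pred w | [exists y, e w y && e u y]]|%:R <= X * 3 ^+ d.
  apply: pcount (card_common_exists c0 dc u r2) _ _.
    by rewrite !addr_ge0 // ltW.
  nra.
have mu0 : 0 < mu by rewrite mulr_gt0 // expR_gt0.
set y := X * (1 + h) + h * X.
have y0 : 0 <= y by rewrite /y; nra.
pose D := (Num.truncn y).+1.
have /andP[yD Dy] := natr_truncnS y0; rewrite -/D in yD Dy.
have XD : X <= D%:R by apply: le_trans yD; rewrite /y; nra.
have DX : D%:R <= X * (1 + 3 * h) by apply: (le_trans Dy); rewrite /y; lra.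
have D0 : (0 < D)%N by [].
have DR : 0 < D%:R :> R by rewrite ltr0n.
have lnXD : ln X <= ln D%:R by rewrite ler_ln ?posrE.
have lnD0 : 0 < ln (D%:R : R) by apply: lt_le_trans lnXD; exact: lt_le_trans lnX1.
have lnD2 : ln D%:R <= 2 * ln X.
  have : ln (D%:R : R) <= ln (2 * X).
    rewrite ler_ln ?posrE ?mulr_gt0 //; clear -DX X0 h16; nra.
  rewrite lnM ?posrE //; have := @le_ln1Dx R 1; rewrite (_ : 1 + 1 = 2 :> R) //.
  move=> /(_ (lt_trans (ltrN10 R) ltr01)); clear -lnX1; lra.
(* Twice the mean bound [mu] fits under the codegree allowed by the nibble because
   [ln D <= 2 * ln X]; the factor [32] in [C5] is [2 * 2 ^ 4]. *)
have KD : mu + mu <= ln (D%:R : R) ^- 4 * D%:R.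
  rewrite mulrC ler_pdivlMr ?exprn_gt0 //.
  have ln4 : ln (D%:R : R) ^+ 4 <= (2 * ln X) ^+ 4.
    by apply: lerXn2r => //; rewrite nnegrE; [|apply: le_trans lnD2]; exact: ltW.
  apply: le_trans XD; apply: (@le_trans _ _ ((mu + mu) * (2 * ln X) ^+ 4)).
    by rewrite ler_pM2l // addr_gt0.
  have -> : (mu + mu) * (2 * ln X) ^+ 4 =
    X * (32 * ln X ^+ 4 * expR (- (d%:R / (64 * x ^+ 2)))) by rewrite /mu; ring.
  by rewrite ler_piMr // ltW.
have pp : 0 < p <= 1 by rewrite p0.
have b1 : expR (- (h / 8 * (h * X)) + 2 * (h / 8) ^+ 2 * (X * (1 + h))) <= h.
  apply: le_trans C2; rewrite ler_expR.
  have h2X : 0 <= h ^+ 2 * X by rewrite mulr_ge0 ?sqr_ge0 // ltW.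
  have : h * (h ^+ 2 * X) <= h ^+ 2 * X by rewrite ler_piMl.
  clear -h2X; lra.
have b2 : expR (- (4^-1 * mu) + 2 * 4^-1 ^+ 2 * mu) <= expR (- (mu / 8)).
  by rewrite ler_expR; clear -mu0; lra.
have m2 : 0 < mu + mu by rewrite addr_gt0.
have [A sA cA] := @sparse_sample R _ e near p _ (h * X) _ _ mu mu _ _ _ _ D _
  (@close_irr R d m (2 * rad)) (@close_irr R d m (rad / x)) pp
  hnear hdeg hcod hfar a1 b1 a2 b2 yD m2 KD.
have [I [IA Ii Ic]] := indep_low_codegree (@close_sym R d m (2 * rad))
  (@close_irr R d m (2 * rad)) h4 D0 (le_trans C4 lnXD) sA.
exists I; split.
  by move=> u w Iu Iw uw; have := Ii u w Iu Iw; rewrite /close uw /= -leNgt.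
apply: le_trans Ic; rewrite card_tuple card_ord natrX in cA.
have pm : p * m%:R ^+ d * (1 - 3 * h) <= #|A|%:R.
  have pm0 : 0 <= p * m%:R ^+ d by apply: mulr_ge0 (ltW p0) _; exact: exprn_ge0.
  apply: le_trans cA; rewrite ler_wpM2l //; clear -C1 C3; lra.
have k0 : 0 <= (1 - 4 * h) * ln D%:R / D%:R.
  by rewrite divr_ge0 ?mulr_ge0 ?(ltW lnD0).
apply: le_trans (ler_wpM2l k0 pm).
have mW : 0 <= m%:R ^+ d / W by rewrite divr_ge0 ?exprn_ge0 // ltW.
have -> : (1 - 4 * h) * ln D%:R / D%:R * (p * m%:R ^+ d * (1 - 3 * h)) =
  (1 - 4 * h) * (1 - 3 * h) * (ln D%:R * (X / D%:R)) * (m%:R ^+ d / W).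
  by rewrite /p; field; rewrite (gt_eqF W0) (gt_eqF DR).
rewrite ler_wpM2r // -!mulrA ler_wpM2l // ler_wpM2l // mulrC.
apply: ler_pM lnXD _; [exact: le_trans lnX1|by rewrite invr_ge0 ltW|].
by rewrite ler_pdivlMr // mulrC ler_pdivrMr.
Qed.

(** * Asymptotics *)

(** With [x ^ 2 = d / (576 * ln d)] one gets [d / (64 * x ^ 2) = 9 * ln d], so [mu = X / d ^ 9],
    enough against [ln X ^ 4 <= d ^ 8]. Compared with [d * ln d / 2], [ln X] loses only
    [d * ln (576 * ln d) / 2]. *)
Lemma asymptotic_parameters (R : realType) (h : R) : 0 < h <= 16^-1 ->
  exists d0 : nat, forall d : nat, (d0 <= d)%N ->
  exists x : R, let X := x ^+ d in
    let mu := X * expR (- (d%:R / (64 * x ^+ 2))) in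
  [/\ (0 < d)%N, 1 <= x & [/\ (3 / 4) ^+ d <= h, expR (- (h ^+ 2 * X / 16)) <= h,
  X * 3 ^+ d * expR (- (mu / 8)) <= h,
  10 ^+ 6 / h ^+ 9 <= ln X & [/\
  32 * ln X ^+ 4 * expR (- (d%:R / (64 * x ^+ 2))) <= 1, 1 <= h * X,
  0 < ln (d%:R : R) & (1 - h) * (d%:R * ln d%:R / 2) <= ln X]]].
Proof.
move=> /andP[h0 h16].
have h1 : h <= 1 by lra.
have hX n : 0 < h ^+ n by rewrite exprn_gt0.
have hX1 n : h ^+ n <= 1 by rewrite exprn_ile1 // ltW.
have [c [cE c1]] : exists c : R, c = 10 ^+ 6 /\ 200 <= c by exists (10 ^+ 6); split=> //; lra.
rewrite -cE {cE}.
(* For [z] beyond [Z0], [(h * z) ^ 2 / 2 >= 576 * z], whence [ln (576 * z) <= h * z]. *)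
pose Z0 : R := 64 * 18 / h ^+ 2.
exists (Num.truncn (expR Z0 + c / h ^+ 9)).+1 => d dd.
have cN0 : 0 <= c / h ^+ 9 by rewrite divr_ge0 ?(ltW (hX _)) //; lra.
have dge : expR Z0 + c / h ^+ 9 <= d%:R.
  have := truncnS_gt (expR Z0 + c / h ^+ 9); move/ltW/le_trans; apply.
  by rewrite ler_nat.
have dZ : expR Z0 <= d%:R by lra.
have dN : c / h ^+ 9 <= d%:R by have := expR_gt0 Z0; lra.
have dR : 0 < d%:R :> R by apply: lt_le_trans dZ; exact: expR_gt0.
have d0 : (0 < d)%N by rewrite -(ltr0n R).
have dh' : c <= d%:R * h ^+ 9 by rewrite -ler_pdivrMr.
have dh n : (n <= 9)%N -> 200 <= d%:R * h ^+ n.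
  move=> n9; apply: (le_trans c1); apply: (le_trans dh'); rewrite ler_wpM2l ?(ltW dR) //.
  by rewrite -(subnKC n9) exprD ler_piMr // ltW.
set z := ln (d%:R : R).
have dE : d%:R = expR z by rewrite lnK.
have Zz : Z0 <= z by rewrite -ler_expR -dE.
have hz : 64 * 18 <= h ^+ 2 * z by move: Zz; rewrite /Z0 ler_pdivrMr // [z * _]mulrC.
have z1 : 64 * 18 <= z.
  apply: (le_trans hz); rewrite ler_piMl //.
  by apply: le_trans Zz; rewrite divr_ge0 // ltW.
have z0 : 0 < z by lra.
move: dN; set N := c / h ^+ 9 => dN.
clear dge dZ dh' Zz Z0 dd cN0 c1.
have F1 : 64 * 9 * z <= expR (h * z).
  have := @expR_ge1Dxn R (h * z) 1 (mulr_ge0 (ltW h0) (ltW z0)).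
  rewrite (_ : 2`!%:R = 2 :> R) //; apply: le_trans.
  have := ler_wpM2r (ltW z0) hz.
  have -> : h ^+ 2 * z * z = (h * z) ^+ 2 by ring.
  lra.
have z2 : 64 <= z by lra.
clear hz z1.
have F1' : 64 * 9 * z <= d%:R.
  by apply: (le_trans F1); rewrite dE ler_expR ler_piMl // ltW.
pose x := Num.sqrt (d%:R / (64 * 9 * z)).
have zz0 : 0 < 64 * 9 * z by lra.
have x2 : x ^+ 2 = d%:R / (64 * 9 * z) by rewrite sqr_sqrtr // divr_ge0 // ltW.
have x1 : 1 <= x.
  rewrite -(@ler_pXn2r _ 2) ?nnegrE ?sqrtr_ge0 // x2 expr1n.
  by rewrite ler_pdivlMr // mul1r.
have x0 : 0 < x by lra.
have ex : d%:R / (64 * x ^+ 2) = 9 * z by rewrite x2; field; rewrite !gt_eqF.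
have lnx : 2 * ln x = z - ln (64 * 9 * z).
  have := congr1 (@ln R) x2; rewrite lnXn // ln_div ?posrE //.
  by rewrite -/z mulr2n => <-; ring.
have lnx_ge : (1 - h) * z <= 2 * ln x.
  have : ln (64 * 9 * z) <= h * z by rewrite -ler_expR lnK ?posrE.
  lra.
have lnx_le : 2 * ln x <= z.
  have : 0 <= ln (64 * 9 * z) by apply: ln_ge0; lra.
  lra.
have lnX : ln (x ^+ d) = d%:R * ln x by rewrite lnXn // mulr_natl.
set X := x ^+ d in lnX.
have X0 : 0 < X by rewrite exprn_gt0.
have XE : X = expR (ln X) by rewrite lnK.
have lnX_ge : (1 - h) * (d%:R * z / 2) <= ln X.
  rewrite lnX (_ : (1 - h) * (d%:R * z / 2) = d%:R * ((1 - h) * z / 2)); last by ring.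
  by rewrite ler_pM2l //; lra.
have lnX_10 : 10 * d%:R <= ln X.
  rewrite lnX mulrC ler_pM2l //.
  have : (1 - h) * z >= 2^-1 * z by rewrite ler_pM2r //; lra.
  lra.
have X10 : expR (10 * d%:R) <= X by rewrite XE ler_expR.
have d200 : 200 <= d%:R :> R by have := dh 0%N isT; rewrite expr0 mulr1; lra.
have X10d : 10 * d%:R <= X by apply: le_trans X10; have := expR_ge1Dx (10 * d%:R : R); lra.
have zd : z <= d%:R by apply: ltW; exact: ln_sublinear.
exists x; split=> //; split.
- have : (3 / 4) ^+ d <= expR (- 4^-1) ^+ d :> R.
    by apply: lerXn2r; rewrite ?nnegrE ?expR_ge0 //; have := expR_ge1Dx (- 4^-1 : R); lra.
  move/le_trans; apply; rewrite -expRM_natl mulrN expRN invf_ple ?posrE ?expR_gt0 //.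
  have := expR_ge1Dx (d%:R * 4^-1 : R); apply: le_trans.
  rewrite -[h^-1]mul1r ler_pdivrMr //.
  have := dh 1%N isT; rewrite expr1; clear -h0; lra.
- rewrite expRN invf_ple ?posrE ?expR_gt0 //.
  have := expR_ge1Dx (h ^+ 2 * X / 16); apply: le_trans.
  rewrite -[h^-1]mul1r ler_pdivrMr //.
  have := ler_wpM2l (ltW (hX 3%N)) X10d; have := dh 3%N isT.
  have -> : (1 + h ^+ 2 * X / 16) * h = h + h ^+ 3 * X / 16 by ring.
  lra.
- rewrite ex; set mu := X * expR (- (9 * z)).
  have mu0 : 0 < mu by rewrite mulr_gt0 // expR_gt0.
  (* The quadratic Taylor term is enough: it leaves [128 * expR (2 * d + 18 * z) / X], and
     [X >= expR (10 * d)]. *)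
  have m8 : mu ^+ 2 / 128 <= expR (mu / 8).
    have := @expR_ge1Dxn R (mu / 8) 1 (divr_ge0 (ltW mu0) (ler0n _ 8)).
    by rewrite (_ : 2`!%:R = 2 :> R) //; apply: le_trans; lra.
  have m80 : 0 < mu ^+ 2 / 128 by rewrite divr_gt0 // exprn_gt0.
  have e3 : 3 ^+ d <= expR (2 * d%:R) :> R.
    rewrite mulrC expRM_natl; apply: lerXn2r; rewrite ?nnegrE ?expR_ge0 //.
    by have := expR_ge1Dx (2 : R); clear; lra.
  have -> : expR (- (mu / 8)) = (expR (mu / 8))^-1 by rewrite expRN.
  apply: (@le_trans _ _ (X * expR (2 * d%:R) * (mu ^+ 2 / 128)^-1)).
    have A1 : X * 3 ^+ d <= X * expR (2 * d%:R) by rewrite ler_pM2l.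
    have A2 : (expR (mu / 8))^-1 <= (mu ^+ 2 / 128)^-1 by rewrite lef_pV2 ?posrE ?expR_gt0.
    apply: ler_pM A1 A2; last by rewrite invr_ge0 expR_ge0.
    by apply: mulr_ge0; [exact: ltW|exact: exprn_ge0].
  have -> : X * expR (2 * d%:R) * (mu ^+ 2 / 128)^-1 =
    128 * expR (2 * d%:R + 18 * z) / X.
    rewrite /mu expRD (_ : 18 * z = 9 * z + 9 * z); last by ring.
    by rewrite expRD expRN; field; rewrite (gt_eqF X0) gt_eqF // expR_gt0.
  rewrite ler_pdivrMr //.
  apply: le_trans (ler_wpM2l (ltW h0) X10).
  have -> : 10 * d%:R = (2 * d%:R + 18 * z) + (8 * d%:R - 18 * z) :> R by ring.
  rewrite [in leRHS]expRD mulrCA mulrC ler_pM2l ?expR_gt0 //.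
  apply: (@le_trans _ _ (h * d%:R)); first by have := dh 1%N isT; rewrite expr1; lra.
  rewrite ler_pM2l //; have := expR_ge1Dx (8 * d%:R - 18 * z); clear -F1' z0; lra.
- by apply: (le_trans dN); lra.
- split=> //.
  + rewrite ex expRN expRM_natl -dE.
    have lnX0 : 0 <= ln X by lra.
    have lnXd : ln X <= d%:R ^+ 2.
      by rewrite lnX expr2 ler_pM2l //; clear -lnx_le zd z0; lra.
    rewrite ler_pdivrMr ?exprn_gt0 // mul1r.
    have : ln X ^+ 4 <= (d%:R ^+ 2) ^+ 4.
      by apply: lerXn2r; rewrite ?nnegrE ?exprn_ge0.
    rewrite -exprM => h8; apply: (@le_trans _ _ (32 * d%:R ^+ (2 * 4))).
      by rewrite ler_pM2l.
    by rewrite (exprS _ 8) ler_pM2r ?exprn_gt0 //; clear -d200; lra.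
  + apply: le_trans (ler_wpM2l (ltW h0) X10d).
    have := dh 1%N isT; rewrite expr1; lra.
Qed.

(** * Assembling the packing *)

Unset Implicit Arguments.

Theorem theorem1p1 (R : realType) :
  forall eps : R, 0 < eps ->
  exists d0 : nat, forall d : nat, (d0 <= d)%N ->
    exists P : set (d.-tuple R), sphere_packing P /\
      (((1 - eps) * d%:R * ln (d%:R) / 2 ^+ d.+1)%:E <= packing_density P)%E.
Proof.
(* The losses [4 * h], [3 * h], [3 * h], [h] and [h] add up to [12 * h < eps]. *)
move=> eps eps0; pose h := Num.min (eps / 16) 16^-1.
have h0 : 0 < h by rewrite lt_min divr_gt0 //= invr_gt0.
have h1 : h <= eps / 16 by rewrite ge_min lexx.
have h2 : h <= 16^-1 by rewrite ge_min lexx orbT.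
have h01 : 0 < h <= 16^-1 by rewrite h0.
clearbody h.
have [d0 asym] := asymptotic_parameters h01; exists d0 => d /asym[x [] dpos x1].
set X := x ^+ d => -[C1 C2 C3 C4 [C5 C6 z0 lnX]].
have [r0 rv] := r_P R dpos.
have v0 := ballvol1_gt0 R d.
set v := ballvol d 1 in rv v0; set r := r_ R d in r0 rv.
have dR : 0 < d%:R :> R by rewrite ltr0n.
pose c : R := d%:R + 1; have c0 : 0 < c by rewrite ltr_wpDl.
(* One summand for each lower bound required; the last yields [X <= v * (2 * rad) ^ d], as
   [v * (1 + 1 / v) ^ d >= 1]. *)
pose rad := 64 * x ^+ 2 * c + 3 ^+ d * c / h + x * (1 + v^-1).
have x0 : 0 < x by lra.
have t1 : 0 < 64 * x ^+ 2 * c by rewrite mulr_gt0 // mulr_gt0 // exprn_gt0.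
have t2 : 0 < 3 ^+ d * c / h by rewrite divr_gt0 // mulr_gt0 // exprn_gt0.
have v1 : 0 < 1 + v^-1 by rewrite addr_gt0 // invr_gt0.
have t3 : 0 < x * (1 + v^-1) by rewrite mulr_gt0.
have rad0 : 0 < rad by rewrite /rad; lra.
have rad1 : 64 * x ^+ 2 * c <= rad by rewrite /rad; lra.
have rad2 : 3 ^+ d * c <= h * rad by rewrite [h * _]mulrC -ler_pdivrMr // /rad; lra.
have rad4 : x * (1 + v^-1) <= rad by rewrite /rad lerDr addr_ge0 // ltW.
clearbody rad.
have rad3 : X <= v * (2 * rad) ^+ d.
  apply: (@le_trans _ _ (v * (x * (1 + v^-1)) ^+ d)); last first.
    rewrite ler_pM2l //; apply: lerXn2r; rewrite ?nnegrE ?(ltW t3) ?mulr_ge0 ?(ltW rad0) //.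
    by apply: (le_trans rad4); lra.
  rewrite exprMn mulrCA ler_peMr ?exprn_ge0 ?(ltW x0) //.
  rewrite -ler_pdivrMl // mulr1; apply: (@le_trans _ _ (1 + v^-1)); first lra.
  by rewrite -[leLHS]expr1 ler_weXn2l // lerDl invr_ge0 ltW.
(* [M2] is the corridor width; [m] is so large that corridors waste at most a fraction [h] of the
   volume. *)
have [M2 M2r] : exists M2 : nat, 2 * rad <= M2%:R.
  by exists (Num.truncn (2 * rad)).+1; apply: ltW; exact: truncnS_gt.
have [m [m0 mM]] : exists m : nat, (0 < m)%N /\ d%:R * M2%:R / h <= m%:R.
  by exists (Num.truncn (d%:R * M2%:R / h)).+1; split=> //; apply: ltW; exact: truncnS_gt.
pose m' := (m + M2)%N.
have mm' : (m <= m')%N by exact: leq_addr.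
have m'0 : 0 < m'%:R :> R by rewrite ltr0n (leq_trans m0).
have [I [Isep Icard]] := @box_indep R d m x h rad dpos x1 h01 rad1 rad2 rad3 C1 C2 C3 C4 C5 C6.
(* Rescales the conflict distance [2 * rad] to [2 * r]. *)
pose hs := r / rad.
have hs0 : 0 < hs by rewrite divr_gt0.
exists (tiling m' hs I); split.
  apply: (@tiling_packing R d m m' hs I rad) => //.
    by rewrite /hs divfK // gt_eqF.
  by rewrite natrD; lra.
apply: tiling_density => //.
have ratio : 1 - h <= (m%:R / m'%:R) ^+ d.
  have -> : m%:R / m'%:R = 1 - M2%:R / m'%:R :> R.
    by rewrite /m' natrD; field; rewrite -natrD gt_eqF.
  have p01 : 0 <= (M2%:R / m'%:R : R) <= 1.
    by rewrite divr_ge0 // ler_pdivrMr // mul1r ler_nat leq_addl.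
  apply: le_trans (bernoulli_ineq d p01); rewrite lerD2l lerN2 mulrA ler_pdivrMr //.
  rewrite -ler_pdivrMl // mulrC; apply: (le_trans mM); by rewrite ler_nat.
set k := (1 - 4 * h) * (1 - 3 * h) / (1 + 3 * h) in Icard.
have k0 : 0 < k by rewrite /k divr_gt0 ?mulr_gt0 //; lra.
have kh : 1 - 12 * h <= k * ((1 - h) * (1 - h)).
  have -> : k * ((1 - h) * (1 - h)) =
    (1 - 4 * h) * (1 - 3 * h) * ((1 - h) * (1 - h)) / (1 + 3 * h) by rewrite /k; ring.
  rewrite ler_pdivlMr; nra.
have lnX0 : 0 < ln X.
  by apply: lt_le_trans lnX; rewrite mulr_gt0 ?divr_gt0 ?mulr_gt0 //; lra.
have hm0 : 0 < (hs * m'%:R) ^+ d by rewrite exprn_gt0 // mulr_gt0.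
apply: (@lt_le_trans _ _ (k * ln X * (m%:R ^+ d / (v * (2 * rad) ^+ d)) /
                           (hs * m'%:R) ^+ d)); last first.
  by rewrite ler_pM2r // invr_gt0.
(* As [v * r ^ d = 1], the conflict ball of radius [2 * r] has volume [2 ^ d]. *)
have -> : k * ln X * (m%:R ^+ d / (v * (2 * rad) ^+ d)) / (hs * m'%:R) ^+ d =
  k * ln X * (m%:R / m'%:R) ^+ d / 2 ^+ d.
  have -> : (hs * m'%:R) ^+ d = r ^+ d * m'%:R ^+ d / rad ^+ d.
    by rewrite /hs !exprMn exprVn; ring.
  rewrite exprMn expr_div_n.
  have rd0 : r ^+ d != 0 by rewrite expf_neq0 // gt_eqF.
  have -> : v = (r ^+ d)^-1 by apply: (mulfI rd0); rewrite rv mulfV.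
  field; rewrite !expf_eq0 (gt_eqF m'0) (gt_eqF r0) (gt_eqF rad0).
  by rewrite (_ : 2 == 0 = false) ?andbF // pnatr_eq0.
have e2 : 0 < 2 ^+ d :> R by rewrite exprn_gt0.
set z := ln (d%:R : R) in z0 lnX *.
have -> : (1 - eps) * d%:R * z / 2 ^+ d.+1 = (1 - eps) * (d%:R * z / 2) / 2 ^+ d.
  by rewrite exprS; field; rewrite gt_eqF.
rewrite ltr_pM2r ?invr_gt0 //.
have dz : 0 < d%:R * z / 2 by rewrite divr_gt0 // mulr_gt0.
apply: (@lt_le_trans _ _ ((1 - 12 * h) * (d%:R * z / 2))).
  by rewrite ltr_pM2r //; lra.
apply: (le_trans (ler_wpM2r (ltW dz) kh)).
have -> : k * ((1 - h) * (1 - h)) * (d%:R * z / 2) =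
  k * (((1 - h) * (d%:R * z / 2)) * (1 - h)) by ring.
rewrite -[leRHS]mulrA ler_pM2l //; apply: ler_pM => //; last lra.
by rewrite mulr_ge0 ?(ltW dz) //; lra.
Qed.
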